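(* Let $k,m\in\mathbb{N}$ with $1\le m\le k$, let $c,d>-1$, and let $\alpha(\cdot)$ be a real-valued function on $(-1,1]$ with $k-1<\alpha(y)<k$ for all $y$. For $y\in(-1,1]$ and integers $j\ge 0$, $n\ge 0$, write $\frac{d^n}{dy^n}\hat R_j^{c,d,\alpha(y)}(y)$ for the $n$-th derivative with the order frozen at $\alpha(y)$, as defined in the context. Then for every $y\in(-1,1]$, $$\frac{d^m}{dy^m}\hat R_0^{c,d,\alpha(y)}(y)=\frac{(y+1)^{k-\alpha(y)-m}}{\Gamma(k-\alpha(y)+1-m)},$$ $$\frac{d^m}{dy^m}\hat R_1^{c,d,\alpha(y)}(y)=P_1^{c,d}(-1)\frac{(y+1)^{k-\alpha(y)-m}}{\Gamma(k-\alpha(y)+1-m)}+\frac{c+d+2}{2}\,\frac{(y+1)^{k-\alpha(y)+1-m}}{\Gamma(k-\alpha(y)+2-m)},$$ and for every $j\ge 1$, $$\begin{aligned}\frac{d^m}{dy^m}\hat R_{j+1}^{c,d,\alpha(y)}(y)={}&\left(\widetilde A_j^{c,d,\alpha(y)}y-\widetilde B_j^{c,d,\alpha(y)}\right)\frac{d^m}{dy^m}\hat R_j^{c,d,\alpha(y)}(y)-\widetilde C_j^{c,d,\alpha(y)}\frac{d^m}{dy^m}\hat R_{j-1}^{c,d,\alpha(y)}(y)\\&+m\,\widetilde A_j^{c,d,\alpha(y)}\frac{d^{m-1}}{dy^{m-1}}\hat R_j^{c,d,\alpha(y)}(y)+\frac{(k-\alpha(y))\,\widetilde D_j^{c,d,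\alpha(y)}}{\Gamma(k-\alpha(y)+1-m)}(y+1)^{k-\alpha(y)-m}.\end{aligned}$$
   Context: $P_j^{c,d}$ denotes the Jacobi polynomial of degree $j$ with parameters $c,d>-1$, with the standard normalization $P_j^{c,d}(1)=\frac{\Gamma(j+c+1)}{j!\,\Gamma(c+1)}$ (orthogonal on $(-1,1)$ with weight $(1-s)^c(1+s)^d$). For a constant $\beta\in(k-1,k)$ and $z>-1$, put $$\hat R_j^{c,d,\beta}(z)=\frac{1}{\Gamma(k-\beta)}\int_{-1}^z\frac{P_j^{c,d}(s)}{(z-s)^{\beta-k+1}}\,ds .$$ The notation $\frac{d^n}{dy^n}\hat R_j^{c,d,\alpha(y)}(y)$ means: set $\beta=\alpha(y)$ (a fixed number), differentiate $z\mapsto \hat R_j^{c,d,\beta}(z)$ $n$ times in $z$, and evaluate at $z=y$ (for $n=0$ it is $\hat R_j^{c,d,\alpha(y)}(y)$ itself). This matches the definition of the variable-order Riemann–Liouville derivative, in which the order is held at $\alpha(y)$ during differentiation. Coefficients, for $j\ge1$. Three-term recurrence coefficients, so that $P_{j+1}^{c,d}(s)=(A_j^{c,d}s-B_j^{c,d})P_j^{c,d}(s)-C_j^{c,d}P_{j-1}^{c,d}(s)$: $$A_j^{c,d}=\frac{(2j+c+d+1)(2j+c+d+2)}{2(j+1)(j+c+d+1)},\quad B_j^{c,d}=\frac{(d^2-c^2)(2j+c+d+1)}{2(j+1)(j+c+d+1)(2j+c+d)},$$ $$C_j^{c,d}=\frac{(j+c)(j+d)(2j+c+d+2)}{(j+1)(j+c+d+1)(2j+c+d)}.$$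 Derivative-relation coefficients, so that $P_j^{c,d}=\widehat A_j^{c,d}\frac{d}{ds}P_{j-1}^{c,d}+\widehat B_j^{c,d}\frac{d}{ds}P_j^{c,d}+\widehat C_j^{c,d}\frac{d}{ds}P_{j+1}^{c,d}$: $$\widehat A_j^{c,d}=\frac{-2(j+c)(j+d)}{(j+c+d)(2j+c+d)(2j+c+d+1)},\quad \widehat B_j^{c,d}=\frac{2(c-d)}{(2j+c+d)(2j+c+d+2)},$$ $$\widehat C_j^{c,d}=\frac{2(j+c+d+1)}{(2j+c+d+1)(2j+c+d+2)},$$ with the convention $\widehat A_1^{c,d}=0$ when $c+d=-1$. Finally, with $\mu=k-\alpha(y)$, $$\widetilde A_j^{c,d,\alpha(y)}=\frac{A_j^{c,d}}{1+\mu A_j^{c,d}\widehat C_j^{c,d}},\quad \widetilde B_j^{c,d,\alpha(y)}=\frac{B_j^{c,d}+\mu A_j^{c,d}\widehat B_j^{c,d}}{1+\mu A_j^{c,d}\widehat C_j^{c,d}},\quad \widetilde C_j^{c,d,\alpha(y)}=\frac{C_j^{c,d}+\mu A_j^{c,d}\widehat A_j^{c,d}}{1+\mu A_j^{c,d}\widehat C_j^{c,d}},$$ $$\widetilde D_j^{c,d,\alpha(y)}=\frac{A_j^{c,d}\left(\widehat A_j^{c,d}P_{j-1}^{c,d}(-1)+\widehat B_j^{c,d}P_j^{c,d}(-1)+\widehat C_j^{c,d}P_{j+1}^{c,d}(-1)\right)}{1+\mu A_j^{c,d}\widehat C_j^{c,d}}.$$ *)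

(* Defs.v *)
From mathcomp Require Import all_boot all_order all_algebra.
From mathcomp Require Import all_classical all_reals all_analysis.

Set Implicit Arguments.
Unset Strict Implicit.
Unset Printing Implicit Defensive.

Import Order.TTheory GRing.Theory Num.Theory.
Import numFieldNormedType.Exports.

Local Open Scope classical_set_scope.
Local Open Scope ring_scope.

Definition euler_gamma (R : realType) (x : R) : R :=
  \int[lebesgue_measure]_(t in `]0, +oo[) (t `^ (x - 1) * expR (- t)).

(* For x <= 0 the Euler integral diverges: Gamma is continued by
   Gamma x = Gamma (x + n) / (x (x + 1) ... (x + n - 1)), where n is the least
   natural number with 0 < x + n.  At the poles 0, -1, -2, ... the value is 0,
   by the convention 0^-1 = 0. *)
Definition Gamma (R : realType) (x : R) : R :=
  if 0 < x then euler_gamma x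
  else let n := (Num.truncn (- x)).+1 in
       euler_gamma (x + n%:R) / \prod_(i < n) (x + i%:R).

Definition is_jacobi (R : realType) (c d : R) (j : nat) (p : {poly R}) : Prop :=
  [/\ size p = j.+1,
      forall q : {poly R}, (size q <= j)%N ->
        \int[lebesgue_measure]_(s in `]-1, 1[)
          (p.[s] * q.[s] * ((1 - s) `^ c * (1 + s) `^ d)) = 0
    & p.[1] = Gamma (j%:R + c + 1) / ((j`!)%:R * Gamma (c + 1))].

(* For c, d > -1 exactly one polynomial satisfies is_jacobi c d j, so the
   default value 0 of xget is irrelevant. *)
Definition jacobi (R : realType) (c d : R) (j : nat) : {poly R} :=
  xget 0 [set p | is_jacobi c d j p].

Definition Rhat (R : realType) (k : nat) (c d beta : R) (j : nat) (z : R) : R :=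
  (Gamma (k%:R - beta))^-1 *
  \int[lebesgue_measure]_(s in `]-1, z[)
    ((jacobi c d j).[s] / (z - s) `^ (beta - k%:R + 1)).

Section Coefficients.
Variables (R : realType) (c d : R).
Implicit Types j : nat.

Definition coefA j : R :=
  ((2 * j%:R + c + d + 1) * (2 * j%:R + c + d + 2)) /
  (2 * (j%:R + 1) * (j%:R + c + d + 1)).

Definition coefB j : R :=
  ((d ^+ 2 - c ^+ 2) * (2 * j%:R + c + d + 1)) /
  (2 * (j%:R + 1) * (j%:R + c + d + 1) * (2 * j%:R + c + d)).

Definition coefC j : R :=
  ((j%:R + c) * (j%:R + d) * (2 * j%:R + c + d + 2)) /
  ((j%:R + 1) * (j%:R + c + d + 1) * (2 * j%:R + c + d)).

Definition hatA j : R :=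
  if (j == 1%N) && (c + d == -1) then 0 else
  (- 2 * (j%:R + c) * (j%:R + d)) /
  ((j%:R + c + d) * (2 * j%:R + c + d) * (2 * j%:R + c + d + 1)).

Definition hatB j : R :=
  (2 * (c - d)) / ((2 * j%:R + c + d) * (2 * j%:R + c + d + 2)).

Definition hatC j : R :=
  (2 * (j%:R + c + d + 1)) / ((2 * j%:R + c + d + 1) * (2 * j%:R + c + d + 2)).

(* In the coefficients below, mu stands for k - alpha(y). *)
Definition tildeA (mu : R) j : R := coefA j / (1 + mu * coefA j * hatC j).

Definition tildeB (mu : R) j : R :=
  (coefB j + mu * coefA j * hatB j) / (1 + mu * coefA j * hatC j).

Definition tildeC (mu : R) j : R :=
  (coefC j + mu * coefA j * hatA j) / (1 + mu * coefA j * hatC j).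

Definition tildeD (mu : R) j : R :=
  coefA j * (hatA j * (jacobi c d j.-1).[-1] + hatB j * (jacobi c d j).[-1]
             + hatC j * (jacobi c d j.+1).[-1])
  / (1 + mu * coefA j * hatC j).

End Coefficients.

(* Main.v *)
Require Import Defs.
From mathcomp Require Import all_boot all_order all_algebra.
From mathcomp Require Import all_classical all_reals all_analysis.
From mathcomp Require Import measurable_realfun ring lra zify.

Set Implicit Arguments.
Unset Strict Implicit.
Unset Printing Implicit Defensive.

Import Order.TTheory GRing.Theory Num.Theory.
Import numFieldNormedType.Exports.

Local Open Scope classical_set_scope.
Local Open Scope ring_scope.

(** For a fixed order beta put u = k - beta, which lies in (0, 1), and x = z + 1,
    and let I^v be the Riemann-Liouville integral of order v based at -1, so that
    the function to study is I^u P_j.  Two rules govern I^u: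
    - I^u ((s + 1) p) = x I^u p - u I^(u+1) p, because s + 1 = x - (z - s) and the
      factor z - s raises the order of the kernel by one;
    - I^(u+1) (Q') = I^u Q - Q(-1) x^u / Gamma(u + 1), by parts.
    The three-term recurrence and the first rule express I^u P_(j+1) through
    I^u P_j, I^u P_(j-1) and I^(u+1) P_j.  The derivative relation says that
    P_j = Q' with Q a combination of P_(j-1), P_j, P_(j+1), so the second rule
    turns I^(u+1) P_j into I^u Q, in which I^u P_(j+1) occurs again, with
    coefficient u A Chat after multiplication by A.  Moving that term to the left
    and dividing by 1 + u A Chat = 1 + u / (j + 1) > 0 produces the coefficients
    with a tilde, and differentiating m times produces the statement.

    The n-th derivative of I^u ((s + 1)^i) is i! x^(u+i-n) / Gamma(u+i+1-n)
    [jint_frac_monomial, is_derive_frac_kernel], so both rules are checked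
    directly for n-th derivatives as relations between these monomials
    [frac_deriv_mulX1, frac_deriv_of_deriv]; the case i = 0, 1 gives the first two
    formulas, and [frac_jacobi_recurrence] is the argument above.

    The polynomial P_j is specified by orthogonality and its value at 1, so its
    two algebraic relations have to be derived from there.  On an interval with
    endpoints a < b and weight w = (b - s)^c (s - a)^d, the integral over the
    interval of the derivative of (b - s) (s - a) w q vanishes; this is the
    Pearson identity [jint_pearson].
    For w on (-1, 1) it makes the hypergeometric operator in (1 - s) / 2 symmetric.
    The explicit hypergeometric sums are eigenvectors of that operator with
    distinct eigenvalues, hence orthogonal, and positivity of w gives uniqueness
    [jacobiE].  Both relations then become identities between explicit
    coefficients.  For w = (z - s)^(u-1) on (-1, z) the same identity is a
    recurrence in i for the fractional integrals of (s + 1)^i, so that no Beta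
    function is involved. *)

(** * Improper integrals by exhaustion *)

Section ImproperFTC.
Variable R : realType.
Implicit Types (al be : nat -> R) (f F : R -> R) (D : set R).

Local Notation mu := (@lebesgue_measure R).

Lemma is_derive_continuous (f : R -> R) (x l : R) :
  is_derive x 1 f l -> {for x, continuous f}.
Proof.
by case=> df _; apply: differentiable_continuous; exact/derivable1_diffP.
Qed.

(** Improper integrals over bounded and unbounded intervals are treated at once,
    as limits over increasing compact intervals. *)
Definition exhausts al be D :=
  [/\ forall n, al n < be n,
      nondecreasing_seq (fun n => `[al n, be n]%classic)
    & D = \bigcup_n `[al n, be n]%classic].

Lemma exhausts_sub al be D n : exhausts al be D -> `[al n, be n] `<=` D.
Proof. by case=> _ _ -> x; exists n. Qed.

Lemma exhausts_measurable al be D : exhausts al be D -> measurable D.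
Proof. by case=> _ _ ->; exact: bigcupT_measurable. Qed.

Lemma exhausts_measurable_fun al be D f : exhausts al be D ->
  (forall x, D x -> {for x, continuous f}) -> measurable_fun D f.
Proof.
move=> ex cf; have [_ _ ->] := ex.
apply/measurable_fun_bigcup => // n.
apply: subspace_continuous_measurable_fun => //.
apply: continuous_in_subspaceT => x; rewrite inE => xI.
by apply: cf; exact: exhausts_sub xI.
Qed.

Lemma exhausts_FTC al be D f F n : exhausts al be D ->
  (forall x, D x -> {for x, continuous f}) ->
  (forall x, D x -> is_derive x 1 F (f x)) ->
  (\int[mu]_(x in `[al n, be n]) (f x)%:E = (F (be n) - F (al n))%:E)%E.
Proof.
move=> ex cf dF; have sD := @exhausts_sub _ _ _ n ex.
have [ab _ _] := ex; move: (ab n) => {}ab.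
have cF x : D x -> F y @[y --> x] --> F x.
  move=> Dx; apply: differentiable_continuous; apply/derivable1_diffP.
  by have [] := dF _ Dx.
have memI x : x \in `]al n, be n[ -> D x.
  move=> xI; apply: sD; rewrite /= in_itv /=.
  by rewrite !ltW // (itvP xI).
rewrite (@continuous_FTC2 _ f F (al n) (be n)) // ?EFinB //.
- apply: continuous_in_subspaceT => x; rewrite inE => xI.
  by apply: cf; exact: sD.
- split.
  + by move=> x /memI Dx; have [] := dF _ Dx.
  + by apply: cvg_at_right_filter; apply: cF; apply: sD; rewrite /= in_itv /= lexx ltW.
  + by apply: cvg_at_left_filter; apply: cF; apply: sD; rewrite /= in_itv /= lexx ltW.
- by move=> x /memI Dx; rewrite derive1E; have [_ ->] := dF _ Dx.
Qed.

(** For a nonnegative integrand, integrability need not be assumed: monotone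
    convergence bounds the integral by the limit of the increments of a primitive. *)
Lemma exhausts_FTC_ge0 al be D f F (l : R) : exhausts al be D ->
  (forall x, D x -> {for x, continuous f}) ->
  (forall x, D x -> is_derive x 1 F (f x)) ->
  (forall x, D x -> 0 <= f x) ->
  F (be n) - F (al n) @[n --> \oo] --> l ->
  mu.-integrable D (EFin \o f).
Proof.
move=> ex cf dF f0 Fl; have mf := exhausts_measurable_fun ex cf.
apply/integrableP; split; first exact/measurable_EFinP.
rewrite (_ : (\int[mu]_(x in D) _ = l%:E)%E) ?ltry //.
transitivity (\int[mu]_(x in D) (f x)%:E)%E.
  by apply: eq_integral => x; rewrite inE => /f0 fx; rewrite gee0_abs.
have [_ nd DE] := ex.
have cvgI : (\int[mu]_(x in `[al i, be i]) (f x)%:E @[i --> \oo] -->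
    \int[mu]_(x in D) (f x)%:E)%E.
  rewrite DE; apply: ge0_nondecreasing_set_cvg_integral => // [i|i x].
    apply/measurable_EFinP; apply: measurable_funS mf.
      exact: exhausts_measurable ex.
    exact: exhausts_sub ex.
  by move/(exhausts_sub ex)/f0; rewrite lee_fin.
move/cvg_lim : cvgI => <- //; apply/cvg_lim => //.
under eq_fun do rewrite /= (exhausts_FTC _ ex cf dF).
by apply: cvg_EFin => //; exact: nearW.
Qed.

(** A sign-changing integrand is handled by dominated convergence, with the
    absolute value of the integrand itself as the dominating function. *)
Lemma exhausts_FTC_integrable al be D f F (l : R) : exhausts al be D ->
  (forall x, D x -> {for x, continuous f}) ->
  (forall x, D x -> is_derive x 1 F (f x)) ->
  mu.-integrable D (EFin \o f) ->
  F (be n) - F (al n) @[n --> \oo] --> l ->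
  \int[mu]_(x in D) f x = l.
Proof.
move=> ex cf dF fi Fl; have mf := exhausts_measurable_fun ex cf.
have mD := exhausts_measurable ex; have [_ nd DE] := ex.
pose g n := (EFin \o f) \_ `[al n, be n].
have gE n : (\int[mu]_(x in D) g n x = (F (be n) - F (al n))%:E)%E.
  rewrite -(exhausts_FTC n ex cf dF) -integral_mkcondr.
  by congr (integral _ _ _); apply/setIidPr; exact: exhausts_sub ex.
have [||||| _ _ cvgI] :=
    @dominated_convergence _ _ _ mu D mD g (EFin \o f) (abse \o (EFin \o f)).
- move=> n; apply/measurable_restrict => //.
  apply/measurable_EFinP; apply: measurable_funS mf => //; exact: subIsetl.
- exact/measurable_EFinP.
- apply: aeW => x; rewrite {1}DE => -[N _ xN].
  have sN n : (N <= n)%N -> `[al N, be N] `<=` `[al n, be n].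
    by move=> /nd /subsetPset.
  apply: cvg_near_cst; near=> n; rewrite /g patchE mem_set //.
  by apply: sN xN; near: n; exact: nbhs_infty_ge.
- exact: integrable_abse.
- apply: aeW => x n Dx; rewrite /g patchE; case: ifPn => _ //.
  by rewrite (_ : point = 0%E) // abse0; exact: abse_ge0.
rewrite /Rintegral (_ : (\int[mu]_(x in D) _ = l%:E)%E) //.
move/cvg_lim : cvgI => <- //; apply/cvg_lim => //=.
under eq_fun do rewrite gE.
by apply: cvg_EFin => //; exact: nearW.
Unshelve. all: by end_near. Qed.

(** The offset 3 makes the left end smaller than the right end already for n = 0. *)
Definition itvoo_left (a b : R) n : R := a + (b - a) / n.+3%:R.
Definition itvoo_right (a b : R) n : R := b - (b - a) / n.+3%:R.

Lemma exhausts_itvoo a b : a < b -> exhausts (itvoo_left a b) (itvoo_right a b) `]a, b[.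
Proof.
move=> ab; have h0 : 0 < b - a by rewrite subr_gt0.
have n0 n : (0 : R) < n.+3%:R by rewrite ltr0n.
split.
- move=> n; rewrite /itvoo_left /itvoo_right -subr_gt0.
  rewrite (_ : _ - _ = (b - a) * (1 - 2 / n.+3%:R)); last by ring.
  by rewrite mulr_gt0 // subr_gt0 ltr_pdivrMr // mul1r ltr_nat.
- move=> m n mn; apply/subsetPset; apply: subset_itv;
    rewrite bnd_simp /itvoo_left /itvoo_right ?lerD2l ?lerN2 ler_pM2l // lef_pV2 ?posrE //;
    by rewrite ler_nat !ltnS.
- apply/seteqP; split => x /=.
    rewrite in_itv /= => /andP[ax xb].
    pose e := Num.min (x - a) (b - x).
    have e0 : 0 < e by rewrite lt_min !subr_gt0 ax.
    exists (Num.truncn ((b - a) / e)) => //=.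
    have he : (b - a) / (Num.truncn ((b - a) / e)).+3%:R <= e.
      rewrite ler_pdivrMr // mulrC -ler_pdivrMr //; apply/ltW.
      apply: (lt_le_trans (truncnS_gt _)).
      by rewrite ler_nat !ltnS leqW // leqW.
    move: he; rewrite in_itv /= /itvoo_left /itvoo_right le_min.
    by move: (_ / _) => h /andP[h1 h2]; apply/andP; split; lra.
  move=> [n _]; rewrite /= !in_itv /= /itvoo_left /itvoo_right => /andP[h1 h2].
  have : 0 < (b - a) / n.+3%:R by rewrite divr_gt0.
  by move: (_ / _) h1 h2 => h h1 h2 h3; apply/andP; split; lra.
Qed.

Let cvg_div_nat (c : R) : c / n.+3%:R @[n --> \oo] --> 0.
Proof.
rewrite -(mulr0 c); apply: cvgMr.
have := @cvg_harmonic R; rewrite -(cvg_shiftn 2) /harmonic.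
by under eq_fun do rewrite addn2.
Qed.

Definition itv0y_left n : R := n.+2%:R^-1.
Definition itv0y_right n : R := n.+2%:R.

Lemma exhausts_itv0y : exhausts itv0y_left itv0y_right `]0, +oo[.
Proof.
split.
- move=> n; rewrite /itv0y_left /itv0y_right (@lt_le_trans _ _ 1) ?ler1n //.
  by rewrite invf_lt1 ?ltr1n ?ltr0n.
- move=> m n mn; apply/subsetPset; apply: subset_itv;
    rewrite bnd_simp /itv0y_left /itv0y_right ?lef_pV2 ?posrE ?ltr0n //;
    by rewrite ler_nat !ltnS.
- apply/seteqP; split => x /=.
    rewrite in_itv /= andbT => x0.
    exists (maxn (Num.truncn x) (Num.truncn x^-1)) => //=.
    rewrite in_itv /= /itv0y_left /itv0y_right; apply/andP; split.
      rewrite -[leRHS]invrK lef_pV2 ?posrE ?invr_gt0 ?ltr0n //.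
      apply: (le_trans (ltW (truncnS_gt _))).
      by rewrite ler_nat ltnS; apply: leqW; exact: leq_maxr.
    apply: (le_trans (ltW (truncnS_gt _))).
    by rewrite ler_nat ltnS; apply: leqW; exact: leq_maxl.
  move=> [n _]; rewrite /= !in_itv /= andbT => /andP[+ _].
  by apply: lt_le_trans; rewrite invr_gt0 ltr0n.
Qed.

Lemma cvg_itvoo_increment a b F (la lb : R) : a < b ->
  F x @[x --> a^'+] --> la -> F x @[x --> b^'-] --> lb ->
  F (itvoo_right a b n) - F (itvoo_left a b n) @[n --> \oo] --> lb - la.
Proof.
move=> ab /cvg_at_rightP Fa /cvg_at_leftP Fb.
have h0 n : 0 < (b - a) / n.+3%:R by rewrite divr_gt0 ?subr_gt0 ?ltr0n.
apply: cvgB.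
- apply: Fb; split=> [n|]; first by rewrite /itvoo_right ltrBlDr ltrDl.
  by rewrite -[X in _ --> X]subr0; apply: cvgB; [exact: cvg_cst|exact: cvg_div_nat].
- apply: Fa; split=> [n|]; first by rewrite /itvoo_left ltrDl.
  by rewrite -[X in _ --> X]addr0; apply: cvgD; [exact: cvg_cst|exact: cvg_div_nat].
Qed.

Lemma cvg_itv0y_increment F (la lb : R) :
  F x @[x --> 0^'+] --> la -> F x @[x --> +oo] --> lb ->
  F (itv0y_right n) - F (itv0y_left n) @[n --> \oo] --> lb - la.
Proof.
move=> /cvg_at_rightP Fa /cvg_pinftyP Fb.
apply: cvgB.
- apply: Fb; apply/cvgryPge => r; near=> n.
  rewrite /itv0y_right (le_trans (ltW (truncnS_gt _))) // ler_nat.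
  apply: leqW; rewrite ltnS; near: n; exact: nbhs_infty_ge.
- apply: Fa; split=> [n|]; first by rewrite /itv0y_left invr_gt0 ltr0n.
  have := @cvg_harmonic R; rewrite -(cvg_shiftn 1) /harmonic.
  by under eq_fun do rewrite addn1.
Unshelve. all: by end_near. Qed.

Lemma integrable_FTC_ge0_itvoo a b f F (la lb : R) : a < b ->
  (forall x, a < x < b -> {for x, continuous f}) ->
  (forall x, a < x < b -> is_derive x 1 F (f x)) ->
  (forall x, a < x < b -> 0 <= f x) ->
  F x @[x --> a^'+] --> la -> F x @[x --> b^'-] --> lb ->
  mu.-integrable `]a, b[ (EFin \o f).
Proof.
move=> ab cf dF f0 Fa Fb.
have memD x : `]a, b[%classic x -> a < x < b by rewrite /= in_itv.
apply: (exhausts_FTC_ge0 (F := F) (exhausts_itvoo ab) _ _ _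
  (cvg_itvoo_increment ab Fa Fb)) => x /memD;
  by [exact: cf|exact: dF|exact: f0].
Qed.

Lemma Rintegral_FTC_itvoo a b f F (la lb : R) : a < b ->
  (forall x, a < x < b -> {for x, continuous f}) ->
  (forall x, a < x < b -> is_derive x 1 F (f x)) ->
  mu.-integrable `]a, b[ (EFin \o f) ->
  F x @[x --> a^'+] --> la -> F x @[x --> b^'-] --> lb ->
  \int[mu]_(x in `]a, b[) f x = lb - la.
Proof.
move=> ab cf dF fi Fa Fb.
have memD x : `]a, b[%classic x -> a < x < b by rewrite /= in_itv.
apply: (exhausts_FTC_integrable (F := F) (exhausts_itvoo ab) _ _ fi
  (cvg_itvoo_increment ab Fa Fb)) => x /memD;
  by [exact: cf|exact: dF].
Qed.

Lemma integrable_FTC_ge0_itv0y f F (la lb : R) :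
  (forall x : R, 0 < x -> {for x, continuous f}) ->
  (forall x : R, 0 < x -> is_derive x 1 F (f x)) ->
  (forall x : R, 0 < x -> 0 <= f x) ->
  F x @[x --> 0^'+] --> la -> F x @[x --> +oo] --> lb ->
  mu.-integrable `]0, +oo[ (EFin \o f).
Proof.
move=> cf dF f0 Fa Fb.
have memD x : `]0, +oo[%classic x -> 0 < x by rewrite /= in_itv /= andbT.
apply: (exhausts_FTC_ge0 (F := F) exhausts_itv0y _ _ _
  (cvg_itv0y_increment Fa Fb)) => x /memD;
  by [exact: cf|exact: dF|exact: f0].
Qed.

Lemma Rintegral_FTC_itv0y f F (la lb : R) :
  (forall x : R, 0 < x -> {for x, continuous f}) ->
  (forall x : R, 0 < x -> is_derive x 1 F (f x)) ->
  mu.-integrable `]0, +oo[ (EFin \o f) ->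
  F x @[x --> 0^'+] --> la -> F x @[x --> +oo] --> lb ->
  \int[mu]_(x in `]0, +oo[) f x = lb - la.
Proof.
move=> cf dF fi Fa Fb.
have memD x : `]0, +oo[%classic x -> 0 < x by rewrite /= in_itv /= andbT.
apply: (exhausts_FTC_integrable (F := F) exhausts_itv0y _ _ fi
  (cvg_itv0y_increment Fa Fb)) => x /memD;
  by [exact: cf|exact: dF].
Qed.

(** One point of positivity suffices, by continuity: the integrand stays above
    half of its value there on a small interval.  This yields both the positivity
    of Gamma and the definiteness of the Jacobi inner product. *)
Lemma Rintegral_gt0 D f x0 : open D -> D x0 -> {for x0, continuous f} ->
  (forall x, D x -> 0 <= f x) -> mu.-integrable D (EFin \o f) ->
  0 < f x0 -> 0 < \int[mu]_(x in D) f x.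
Proof.
move=> oD Dx0 cf f0 fi fx0; pose h := f x0 / 2.
have h0 : 0 < h by rewrite /h divr_gt0.
have mf : measurable_fun D f by move: fi => /integrableP[/measurable_EFinP].
have : \forall x \near x0, D x /\ h < f x.
  near=> x; split; first by near: x; exact: open_nbhs_nbhs.
  near: x; move: cf => /cvgr_gt; apply.
  by rewrite /h ltr_pdivrMr // ltr_pMr // ltr1n.
move=> /nbhs_ballP[e /= e0 He].
pose I := `[x0, x0 + e / 2]%classic.
have ID x : I x -> D x /\ h < f x.
  rewrite /I /= in_itv /= => /andP[x0x xe]; apply: He; rewrite /ball /=.
  by rewrite ler0_norm ?subr_le0 // opprB; move: (e0); lra.
have Ih : (\int[mu]_(x in I) h%:E = (h * (e / 2))%:E)%E.
  have muI : mu I = (e / 2)%:E.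
    rewrite lebesgue_measure_itv /= lte_fin ltrDl divr_gt0 //.
    by rewrite -EFinB addrAC subrr add0r.
  transitivity (h%:E * mu I)%E; first (apply: integral_cst; exact: measurable_itv).
  by rewrite [X in (_ * X)%E = _]muI EFinM.
apply: fine_gt0; apply/andP; split; last first.
  by apply: integrable_lty => //; exact: open_measurable.
apply: (@lt_le_trans _ _ (\int[mu]_(x in I) h%:E)%E).
  by rewrite Ih lte_fin mulr_gt0 // divr_gt0.
have sID : I `<=` D by move=> x /ID[].
apply: (@le_trans _ _ (\int[mu]_(x in I) (f x)%:E)%E).
  apply: ge0_le_integral => //.
  - exact: measurable_itv.
  - by move=> x _; rewrite lee_fin ltW.
  - by apply/measurable_EFinP; apply: measurable_funS mf => //; exact: open_measurable.
  - by move=> x /ID[_ hx]; rewrite lee_fin ltW.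
apply: ge0_subset_integral => //.
- exact: measurable_itv.
- exact: open_measurable.
- exact/measurable_EFinP.
Unshelve. all: by end_near. Qed.

End ImproperFTC.

(** * Jacobi weights and the Pearson identity *)

Section JacobiWeight.
Variables (R : realType) (a b c d : R).
Hypotheses (ab : a < b) (hc : -1 < c) (hd : -1 < d).

Local Notation mu := (@lebesgue_measure R).
Implicit Types (q : {poly R}) (x s : R).

Definition jweight s : R := (b - s) `^ c * (s - a) `^ d.

Lemma is_derive_powR_left (e x : R) : x < b ->
  is_derive x 1 (fun s => (b - s) `^ e) (- (e * (b - x) `^ (e - 1))).
Proof.
move=> xb.
have dg : is_derive x 1 (fun s => b - s) (-1).
  by apply: is_derive_eq; rewrite add0r mul1r.
have df : is_derive (b - x) 1 (@powR R ^~ e) (e * (b - x) `^ (e - 1)).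
  by apply: is_derive1_powR; rewrite subr_gt0.
by have := @is_derive1_comp _ _ (fun s => b - s) _ _ _ df dg; rewrite mulrN1.
Qed.

Lemma is_derive_powR_right (e x : R) : a < x ->
  is_derive x 1 (fun s => (s - a) `^ e) (e * (x - a) `^ (e - 1)).
Proof.
move=> xb.
have dg : is_derive x 1 (fun s => s - a) 1.
  by apply: is_derive_eq; rewrite subr0.
have df : is_derive (x - a) 1 (@powR R ^~ e) (e * (x - a) `^ (e - 1)).
  by apply: is_derive1_powR; rewrite subr_gt0.
by have := @is_derive1_comp _ _ (fun s => s - a) _ _ _ df dg; rewrite mulr1.
Qed.

Lemma continuous_powR_left (e x : R) : x < b ->
  {for x, continuous (fun s => (b - s) `^ e)}.
Proof. by move=> xb; apply: is_derive_continuous (is_derive_powR_left e xb). Qed.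

Lemma continuous_powR_right (e x : R) : a < x ->
  {for x, continuous (fun s => (s - a) `^ e)}.
Proof. by move=> xb; apply: is_derive_continuous (is_derive_powR_right e xb). Qed.

Lemma cvg_powR_right (e : R) : 0 < e -> (s - a) `^ e @[s --> a^'+] --> 0.
Proof.
move=> /powR_cvg0/cvg_at_rightP pe; apply/cvg_at_rightP => u [ua cu].
apply: (pe (fun n => u n - a)); split=> [n|]; first by rewrite subr_gt0.
by rewrite -[X in _ --> X](subrr a); apply: cvgB => //; exact: cvg_cst.
Qed.

Lemma cvg_powR_left (e : R) : 0 < e -> (b - s) `^ e @[s --> b^'-] --> 0.
Proof.
move=> /powR_cvg0/cvg_at_rightP pe; apply/cvg_at_leftP => u [ua cu].
apply: (pe (fun n => b - u n)); split=> [n|]; first by rewrite subr_gt0.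
by rewrite -[X in _ --> X](subrr b); apply: cvgB => //; exact: cvg_cst.
Qed.

Lemma integrable_powR_right :
  mu.-integrable `]a, b[ (fun s => ((s - a) `^ d)%:E).
Proof.
have d1 : 0 < d + 1 by rewrite -ltrBlDr sub0r.
apply: (@integrable_FTC_ge0_itvoo _ _ _ (fun s => (s - a) `^ d)
  (fun s => (d + 1)^-1 * (s - a) `^ (d + 1)) ((d + 1)^-1 * 0)
  ((d + 1)^-1 * (b - a) `^ (d + 1))) => //.
- by move=> x /andP[ax _]; exact: continuous_powR_right.
- move=> x /andP[ax _].
  have dF := is_derive_powR_right (d + 1) ax.
  have := is_deriveZ (d + 1)^-1 dF.
  by rewrite /GRing.scale /= mulKf ?gt_eqF // addrK.
- by move=> x _; exact: powR_ge0.
- by apply: cvgMr; exact: cvg_powR_right.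
- by apply: cvg_at_left_filter; apply: cvgMr; exact: continuous_powR_right.
Qed.

Let primitive_powR_left x : x < b ->
  is_derive x 1 (fun s => - (c + 1)^-1 * (b - s) `^ (c + 1)) ((b - x) `^ c).
Proof.
move=> xb; have c1 : 0 < c + 1 by rewrite -ltrBlDr sub0r.
have := is_deriveZ (- (c + 1)^-1) (is_derive_powR_left (c + 1) xb).
by rewrite /GRing.scale /= mulrNN mulKf ?gt_eqF // addrK.
Qed.

Lemma integrable_powR_left :
  mu.-integrable `]a, b[ (fun s => ((b - s) `^ c)%:E).
Proof.
have c1 : 0 < c + 1 by rewrite -ltrBlDr sub0r.
apply: (@integrable_FTC_ge0_itvoo _ _ _ (fun s => (b - s) `^ c)
  (fun s => - (c + 1)^-1 * (b - s) `^ (c + 1)) (- (c + 1)^-1 * (b - a) `^ (c + 1))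
  (- (c + 1)^-1 * 0)) => //.
- by move=> x /andP[_ xb]; exact: continuous_powR_left.
- by move=> x /andP[_ xb]; exact: primitive_powR_left.
- by move=> x _; exact: powR_ge0.
- by apply: cvg_at_right_filter; apply: cvgMr; exact: continuous_powR_left.
- by apply: cvgMr; exact: cvg_powR_left.
Qed.

Lemma Rintegral_powR_left :
  \int[mu]_(s in `]a, b[) (b - s) `^ c = (b - a) `^ (c + 1) / (c + 1).
Proof.
have c1 : 0 < c + 1 by rewrite -ltrBlDr sub0r.
rewrite (_ : _ / _ = - (c + 1)^-1 * 0 - - (c + 1)^-1 * (b - a) `^ (c + 1));
  last by rewrite mulr0 sub0r mulNr opprK mulrC.
apply: (@Rintegral_FTC_itvoo _ _ _ (fun s => (b - s) `^ c)
  (fun s => - (c + 1)^-1 * (b - s) `^ (c + 1))) => //.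
- by move=> x /andP[_ xb]; exact: continuous_powR_left.
- by move=> x /andP[_ xb]; exact: primitive_powR_left.
- exact: integrable_powR_left.
- by apply: cvg_at_right_filter; apply: cvgMr; exact: continuous_powR_left.
- by apply: cvgMr; exact: cvg_powR_left.
Qed.

Lemma powR_le_sum_endpoints (u v x e : R) : 0 < u -> u <= x <= v ->
  x `^ e <= u `^ e + v `^ e.
Proof.
move=> u0 /andP[ux xv]; have x0 : 0 < x by lra.
have v0 : 0 < v by lra.
have [e0|e0] := leP 0 e.
  by rewrite ler_wpDl ?powR_ge0 // ge0_ler_powR // nnegrE ltW.
rewrite ler_wpDr ?powR_ge0 //.
rewrite -(opprK e) (powRN u) (powRN x) lef_pV2 ?posrE ?powR_gt0 //.
by rewrite ge0_ler_powR // ?nnegrE ?oppr_ge0 ltW.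
Qed.

Lemma jweight_ge0 s : 0 <= jweight s.
Proof. by rewrite mulr_ge0 ?powR_ge0. Qed.

Lemma jweight_gt0 s : a < s < b -> 0 < jweight s.
Proof. by case/andP=> *; rewrite mulr_gt0 // powR_gt0 // subr_gt0. Qed.

Lemma continuous_jweight s : a < s < b -> {for s, continuous jweight}.
Proof.
case/andP=> as_ sb; apply: cvgM.
  exact: continuous_powR_left.
exact: continuous_powR_right.
Qed.

Let memI s : `]a, b[%classic s -> a < s < b.
Proof. by rewrite /= in_itv. Qed.

Lemma measurable_jweight : measurable_fun `]a, b[ jweight.
Proof.
apply: open_continuous_measurable_fun => // s; rewrite inE => /memI.
exact: continuous_jweight.
Qed.

(** Each of the two power factors is bounded on the half of the interval away
    from its own endpoint, so the weight is dominated by a combination of the two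
    one-sided powers, which have explicit primitives. *)
Lemma integrable_jweight : mu.-integrable `]a, b[ (EFin \o jweight).
Proof.
pose h := (b - a) / 2; have h0 : 0 < h by rewrite /h; move: ab; lra.
pose K (e : R) := h `^ e + (h + h) `^ e.
have K0 e : 0 <= K e by rewrite addr_ge0 ?powR_ge0.
apply: (@le_integrable _ _ _ mu _ _ _ (fun s =>
  ((K c)%:E * ((s - a) `^ d)%:E + (K d)%:E * ((b - s) `^ c)%:E)%E)) => //.
- by apply/measurable_EFinP; exact: measurable_jweight.
- move=> s /memI /andP[as_ sb]; rewrite /= lee_fin.
  rewrite !ger0_norm ?jweight_ge0 ?addr_ge0 ?mulr_ge0 ?powR_ge0 //.
  rewrite /jweight; have [sm|ms] := leP s (a + h).
    rewrite ler_wpDr ?mulr_ge0 ?powR_ge0 //; rewrite ler_wpM2r ?powR_ge0 //.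
    by apply: powR_le_sum_endpoints => //; move: sm; rewrite /h; lra.
  rewrite ler_wpDl ?mulr_ge0 ?powR_ge0 // mulrC ler_wpM2r ?powR_ge0 //.
  by apply: powR_le_sum_endpoints => //; move: ms; rewrite /h; lra.
- apply: integrableD => //; apply: integrableZl => //.
    exact: integrable_powR_right.
  exact: integrable_powR_left.
Qed.

Lemma integrable_poly_jweight q :
  mu.-integrable `]a, b[ (fun s => (q.[s] * jweight s)%:E).
Proof.
apply: (@integrableMr _ _ _ mu _ _ (horner q) (EFin \o jweight)) => //.
- by apply: measurable_funTS; apply: continuous_measurable_fun; exact: continuous_horner.
- have : bounded_set (horner q @` `[a, b]).
    apply: compact_bounded; apply: continuous_compact; last exact: segment_compact.
    by apply: continuous_subspaceT; exact: continuous_horner.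
  move=> [M [Mr qM]]; exists M; split => // N MN x /memI /andP[ax xb].
  by apply: (qM N MN); exists x => //; rewrite /= in_itv /= !ltW.
- exact: integrable_jweight.
Qed.

Definition jint q : R := \int[mu]_(s in `]a, b[) (q.[s] * jweight s).

Lemma jintD p q : jint (p + q) = jint p + jint q.
Proof.
rewrite /jint -RintegralD //; try exact: integrable_poly_jweight.
by apply: eq_Rintegral => s _; rewrite hornerD mulrDl.
Qed.

Lemma jintZ (k : R) q : jint (k *: q) = k * jint q.
Proof.
rewrite /jint -RintegralZl //; last exact: integrable_poly_jweight.
by apply: eq_Rintegral => s _; rewrite hornerZ -mulrA.
Qed.

Lemma jintB p q : jint (p - q) = jint p - jint q.
Proof. by rewrite -[- q]scaleN1r jintD jintZ mulN1r. Qed.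

(** The polynomial r such that r times the weight is the derivative of
    (b - s) (s - a) q times the weight. *)
Definition pearson q : {poly R} :=
  (b%:P - 'X) * ('X - a%:P) * q^`()
  + ((d + 1) *: (b%:P - 'X) - (c + 1) *: ('X - a%:P)) * q.

(** The primitive vanishes at both endpoints, because the exponents c + 1 and
    d + 1 are positive. *)
Lemma jint_pearson q : jint (pearson q) = 0.
Proof.
have c1 : 0 < c + 1 by rewrite -ltrBlDr sub0r.
have d1 : 0 < d + 1 by rewrite -ltrBlDr sub0r.
rewrite [RHS](_ : _ = 0 * (b - a) `^ (d + 1) * q.[b]
  - (b - a) `^ (c + 1) * 0 * q.[a]); last by rewrite mulr0 !mul0r subrr.
apply: (@Rintegral_FTC_itvoo _ a b (fun s => (pearson q).[s] * jweight s)
  (fun s => (b - s) `^ (c + 1) * (s - a) `^ (d + 1) * q.[s])) => //.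
- move=> x xab; apply: cvgM; first exact: continuous_horner.
  exact: continuous_jweight.
- move=> x /andP[ax xb].
  have dl := is_derive_powR_left (c + 1) xb.
  have dr := is_derive_powR_right (d + 1) ax.
  have dq := is_derive_poly q x.
  apply: (is_derive_eq (is_deriveM (is_deriveM dl dr) dq)).
  have bx : b - x != 0 by rewrite subr_eq0 gt_eqF.
  have xa : x - a != 0 by rewrite subr_eq0 gt_eqF.
  have -> : (pearson q).[x] = (b - x) * (x - a) * q^`().[x]
      + ((d + 1) * (b - x) - (c + 1) * (x - a)) * q.[x].
    by rewrite /pearson !(hornerD, hornerM, hornerN, hornerZ, hornerX, hornerC).
  rewrite mulrfctE /jweight !addrK /GRing.scale /=.
  rewrite (@powRD _ (b - x)) ?bx ?implybT // (@powRD _ (x - a)) ?xa ?implybT //.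
  rewrite !powRr1 ?subr_ge0 ?ltW //; ring.
- exact: integrable_poly_jweight.
- apply: cvgM; last by apply: cvg_at_right_filter; exact: continuous_horner.
  apply: cvgM; last exact: cvg_powR_right.
  by apply: cvg_at_right_filter; exact: continuous_powR_left.
- apply: cvgM; last by apply: cvg_at_left_filter; exact: continuous_horner.
  apply: cvgM; first exact: cvg_powR_left.
  by apply: cvg_at_left_filter; exact: continuous_powR_right.
Qed.

End JacobiWeight.

(** * The Gamma function *)

Section GammaFunction.
Variable R : realType.
Implicit Types (x t : R).

Local Notation mu := (@lebesgue_measure R).

Lemma powR_expR x t : (expR t) `^ x = expR (x * t).
Proof. by rewrite /powR gt_eqF ?expR_gt0 // expRK. Qed.

Let bound x : R := (2 * x) `^ x.

(** From t / (2 x) <= exp (t / (2 x)) raised to the power x; half of the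
    exponential decay is kept for integrability. *)
Let powR_le_expR x t : 0 < x -> 0 < t ->
  t `^ x * expR (- t) <= bound x * expR (- (t / 2)).
Proof.
move=> x0 t0; have x20 : 0 < 2 * x by rewrite mulr_gt0.
have tE : t <= 2 * x * expR (t / (2 * x)).
  have := expR_ge1Dx (t / (2 * x)); rewrite addrC => h.
  rewrite -ler_pdivrMl // mulrC; apply: le_trans h.
  by rewrite ler_wpDr.
have h : t `^ x <= bound x * expR (t / 2).
  apply: (le_trans (y := (2 * x * expR (t / (2 * x))) `^ x)).
    by rewrite ge0_ler_powR ?nnegrE ?mulr_ge0 ?expR_ge0 // ltW.
  rewrite powRM ?expR_ge0 ?(ltW x20) // powR_expR /bound.
  rewrite (_ : x * (t / (2 * x)) = t / 2) //.
  by field; rewrite gt_eqF.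
apply: le_trans (ler_wpM2r (expR_ge0 _) h) _.
by rewrite -mulrA -expRD (_ : t / 2 + - t = - (t / 2)) //; field.
Qed.

Let cvg_expR_half : expR (- (t / 2)) @[t --> +oo] --> (0 : R).
Proof.
apply: (@cvg_comp _ _ _ (fun t : R => t / 2) (fun t => expR (- t)) _ (+oo)).
  by apply: gt0_cvgMly => //; exact: cvg_id.
exact: cvgr_expR.
Qed.

Let cvg_powR_expR x : 0 < x -> t `^ x * expR (- t) @[t --> +oo] --> (0 : R).
Proof.
move=> x0; apply: (@squeeze_cvgr _ _ _ _ (cst 0) (fun t => bound x * expR (- (t / 2)))).
- near=> t; rewrite mulr_ge0 ?powR_ge0 ?expR_ge0 //=.
  by apply: powR_le_expR => //; near: t; exact: nbhs_pinfty_gt.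
- exact: cvg_cst.
- by rewrite -[X in _ --> X](mulr0 (bound x)); apply: cvgMr; exact: cvg_expR_half.
Unshelve. all: by end_near. Qed.

Let cvg0_powR_expR x : 0 < x -> t `^ x * expR (- t) @[t --> 0^'+] --> (0 : R).
Proof.
move=> x0; rewrite -[X in _ --> X](mul0r (expR (- 0))); apply: cvgM.
  exact: powR_cvg0.
apply: cvg_at_right_filter; apply: continuous_comp; first exact: opp_continuous.
exact: continuous_expR.
Qed.

Let is_derive_expRN t : is_derive t 1 (fun s => expR (- s)) (- expR (- t)).
Proof.
have dN : is_derive t 1 (fun s : R => - s) (-1).
  exact: is_deriveN.
by have := @is_derive1_comp _ _ (fun s => - s) _ _ _ (is_derive_expR (- t)) dN; rewrite mulrN1.
Qed.

Let is_derive_powR_expR x t : 0 < t ->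
  is_derive t 1 (fun s => s `^ x * expR (- s))
    (x * (t `^ (x - 1) * expR (- t)) - t `^ x * expR (- t)).
Proof.
move=> t0; have dp := @is_derive1_powR R x t t0.
apply: (is_derive_eq (is_deriveM dp (is_derive_expRN t))).
by rewrite /GRing.scale /= addrC mulrN; congr (_ - _); rewrite mulrCA [X in _ * X]mulrC.
Qed.

Let continuous_gamma_integrand x t : 0 < t ->
  {for t, continuous (fun s => s `^ (x - 1) * expR (- s))}.
Proof.
by move=> t0; exact: is_derive_continuous (is_derive_powR_expR (x - 1) t0).
Qed.

(** The derivative of t^x exp(-t) has the wrong sign for large t.  Subtracting a
    multiple of exp(-t/2) from that primitive corrects this, by the bound above, and the
    new derivative g still dominates x times the integrand. *)
Lemma integrable_gamma x : 0 < x ->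
  mu.-integrable `]0, +oo[ (fun t => (t `^ (x - 1) * expR (- t))%:E).
Proof.
move=> x0.
pose g t := x * (t `^ (x - 1) * expR (- t))
            + (bound x * expR (- (t / 2)) - t `^ x * expR (- t)).
pose G t := t `^ x * expR (- t) + (- (2 * bound x)) * expR (- (t / 2)).
have expR_half t : is_derive t 1 (fun s => expR (- (s / 2))) (- (expR (- (t / 2)) / 2)).
  have dN : is_derive t 1 (fun s : R => s / 2) (2^-1).
    apply: is_derive_eq; rewrite /GRing.scale /=; ring.
  have := @is_derive1_comp _ _ (fun s => s / 2) _ _ _ (is_derive_expRN (t / 2)) dN.
  by rewrite mulNr.
have f0 t : 0 <= t `^ (x - 1) * expR (- t) by rewrite mulr_ge0 ?powR_ge0 ?expR_ge0.
have dG t : 0 < t -> is_derive t 1 G (g t).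
  move=> t0.
  have dZ := is_deriveZ (- (2 * bound x)) (expR_half t).
  apply: (is_derive_eq (is_deriveD (is_derive_powR_expR x t0) dZ)).
  by rewrite /GRing.scale /= /g; field.
have cg t : 0 < t -> {for t, continuous g}.
  move=> t0; apply: cvgD; last apply: cvgB.
  - by apply: cvgMr; exact: continuous_gamma_integrand.
  - by apply: cvgMr; exact: (is_derive_continuous (expR_half t)).
  - exact: (is_derive_continuous (is_derive_powR_expR x t0)).
have ig : mu.-integrable `]0, +oo[ (EFin \o g).
  apply: (@integrable_FTC_ge0_itv0y _ g G (0 + (- (2 * bound x)) * expR (- (0 / 2)))
    (0 + (- (2 * bound x)) * 0)) => //.
  - move=> t t0; rewrite addr_ge0 ?mulr_ge0 ?(ltW x0) ?powR_ge0 ?expR_ge0 //.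
    by rewrite subr_ge0 powR_le_expR.
  - apply: cvgD; first exact: cvg0_powR_expR.
    apply: cvg_at_right_filter; apply: cvgMr.
    exact: (is_derive_continuous (expR_half 0)).
  - apply: cvgD; first exact: cvg_powR_expR.
    by apply: cvgMr; exact: cvg_expR_half.
have xg : mu.-integrable `]0, +oo[ (fun t => (x^-1)%:E * (g t)%:E)%E.
  exact: integrableZl.
apply: le_integrable xg => //.
  apply/measurable_EFinP; apply: open_continuous_measurable_fun => //.
  by move=> t; rewrite inE /= in_itv /= andbT; exact: continuous_gamma_integrand.
move=> t /=; rewrite in_itv /= andbT => t0; rewrite lee_fin ger0_norm //.
apply: le_trans (ler_norm _); rewrite ler_pdivlMl // lerDl subr_ge0.
exact: powR_le_expR.
Qed.

(** Integration by parts: t^x exp(-t) vanishes at both ends. *)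
Lemma euler_gammaD1 x : 0 < x -> euler_gamma (x + 1) = x * euler_gamma x.
Proof.
move=> x0; have ix := integrable_gamma x0.
have x10 : 0 < x + 1 by rewrite addr_gt0.
have := integrable_gamma x10; rewrite addrK => ix1.
have ixx : mu.-integrable `]0, +oo[
    (fun t => (x * (t `^ (x - 1) * expR (- t)))%:E).
  exact: (integrableZl _ x ix).
apply/eqP; rewrite /euler_gamma addrK -RintegralZl // eq_sym -subr_eq0.
rewrite -RintegralB //; apply/eqP; rewrite -[RHS](subrr 0).
apply: (@Rintegral_FTC_itv0y _ _ (fun s => s `^ x * expR (- s))).
- move=> t t0; apply: cvgB.
    by apply: cvgMr; exact: continuous_gamma_integrand.
  by have := @continuous_gamma_integrand (x + 1) t t0; rewrite addrK.
- by move=> t; exact: is_derive_powR_expR.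
- exact: (integrableB _ ixx ix1).
- exact: cvg0_powR_expR.
- exact: cvg_powR_expR.
Qed.

Lemma euler_gamma_gt0 x : 0 < x -> 0 < euler_gamma x.
Proof.
move=> x0; apply: (@Rintegral_gt0 _ _ _ 1).
- exact: interval_open.
- by rewrite /= in_itv /= ltr01.
- exact: continuous_gamma_integrand.
- by move=> t _; rewrite mulr_ge0 ?powR_ge0 ?expR_ge0.
- exact: integrable_gamma.
- by rewrite mulr_gt0 ?expR_gt0 ?powR_gt0.
Qed.

Lemma Gamma_gt0 x : 0 < x -> 0 < Gamma x.
Proof. by move=> x0; rewrite /Gamma x0 euler_gamma_gt0. Qed.

(** For negative x the number of shifts used in the continuation drops by one
    from x to x + 1, which accounts for the factor x.  The relation holds also at
    the negative poles, where both sides are 0. *)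
Lemma GammaD1 x : x != 0 -> Gamma (x + 1) = x * Gamma x.
Proof.
move=> xn0; rewrite /Gamma; have [x0|x0] := ltP 0 x.
  by rewrite euler_gammaD1 // addr_gt0.
have {x0}x0 : x < 0 by rewrite lt_neqAle xn0.
have [x1|x1] := ltP 0 (x + 1).
  rewrite (_ : Num.truncn (- x) = 0%N); last by apply/truncn0Pn; rewrite -ltNge; lra.
  by rewrite big_ord1 addr0 mulrCA mulfV // mulr1.
have -> : Num.truncn (- x) = (Num.truncn (- (x + 1))).+1.
  apply/eqP; rewrite truncn_eq; last by rewrite oppr_ge0 ltW.
  have : 0 <= - (x + 1) by rewrite oppr_ge0.
  by move=> /truncn_itv; rewrite -!natr1; lra.
set n := Num.truncn _.
have -> : x + n.+2%:R = x + 1 + n.+1%:R by rewrite -[n.+2%:R]natr1; ring.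
rewrite [in RHS]big_ord_recl /= addr0 invfM [in RHS]mulrCA mulVKf //; congr (_ / _).
by apply: eq_bigr => i _; rewrite /bump /= add1n -natr1; ring.
Qed.

End GammaFunction.

(** * Coefficients of the hypergeometric sums *)

Section JacobiCoefficients.
Variables (R : realType) (c d : R).
Hypotheses (hc : -1 < c) (hd : -1 < d).
Implicit Types (i j k n : nat) (x : R).

Definition rising x n : R := \prod_(i < n) (x + i%:R).

Lemma rising0 x : rising x 0 = 1.
Proof. by rewrite /rising big_ord0. Qed.

Lemma risingSr x n : rising x n.+1 = rising x n * (x + n%:R).
Proof. by rewrite /rising big_ord_recr. Qed.

Lemma risingSl x n : rising x n.+1 = x * rising (x + 1) n.
Proof.
rewrite /rising big_ord_recl addr0; congr (_ * _).
by apply: eq_bigr => i _; rewrite lift0 -natr1; ring.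
Qed.

(** The coefficient of ((1 - s) / 2)^i in the Jacobi polynomial of degree i + k.
    Indexing by k = j - i avoids truncated subtraction. *)
Definition jcoef i k : R :=
  (-1) ^+ i * rising (c + i%:R + 1) k * rising (i%:R + k%:R + c + d + 1) i
  / ((i`!)%:R * (k`!)%:R).

Let fact_neq0 n : (n`!)%:R != 0 :> R.
Proof. by rewrite pnatr_eq0 -lt0n fact_gt0. Qed.

Let factS_natr n : ((n.+1)`!)%:R = (n%:R + 1) * (n`!)%:R :> R.
Proof. by rewrite factS natrM -natr1. Qed.

Let cd2 : - 2 < c + d.
Proof. by move: hc hd; lra. Qed.

(** The coefficients that meet in the three-term and derivative relations are
    rational multiples of one common number W.  After that both relations are
    identities between rational functions.  The factor W is chosen so that
    only denominators that are positive for all c, d > -1 occur. *)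
Let jcoef_values_inner i k (x := i%:R : R) (y := k%:R : R) : exists W : R,
  [/\ jcoef i k.+2 = W * (c + x + 1) * (c + x + y + 2) / ((y + 1) * (y + 2)),
      jcoef i.+1 k = - W * (x + y + c + d + 2) / (x + 1),
      jcoef i.+1 k.+1 = - W * (c + x + y + 2) * (2 * x + y + c + d + 3)
                        / ((x + 1) * (y + 1))
    & jcoef i.+1 k.+2 = - W * (c + x + y + 2) * (c + x + y + 3)
                        * (2 * x + y + c + d + 3) * (2 * x + y + c + d + 4)
                        / ((x + y + c + d + 3) * (x + 1) * (y + 1) * (y + 2))].
Proof.
have x0 : 0 <= x by rewrite ler0n.
have y0 : 0 <= y by rewrite ler0n.
pose S := rising (c + x + 2) k; pose T := rising (x + y + c + d + 3) i.
have e1 n : rising (c + i.+1%:R + 1) n = rising (c + x + 2) n.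
  by congr rising; rewrite -natr1 /x; ring.
have e2 : rising (c + i%:R + 1) k.+2 = (c + x + 1) * (S * (c + x + y + 2)).
  have eq2 : c + i%:R + 1 + 1 = c + x + 2 by rewrite /x; ring.
  by rewrite risingSl risingSr eq2 -/S -/x -/y; ring.
have f1 : rising (i%:R + k.+2%:R + c + d + 1) i = T.
  by congr rising; rewrite -!natr1 /x /y; ring.
have f2 : rising (i.+1%:R + k.+1%:R + c + d + 1) i.+1 = T * (x + x + y + c + d + 3).
  have eq2 : i.+1%:R + k.+1%:R + c + d + 1 = x + y + c + d + 3.
    by rewrite -!natr1 /x /y; ring.
  by rewrite risingSr eq2 -/T -/x; ring.
have f3 : rising (i.+1%:R + k%:R + c + d + 1) i.+1 = (x + y + c + d + 2) * T.
  have eq2 : i.+1%:R + k%:R + c + d + 1 = x + y + c + d + 2.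
    by rewrite -!natr1 /x /y; ring.
  by rewrite risingSl eq2; congr (_ * rising _ _); ring.
have h3 : x + y + c + d + 3 != 0 by rewrite gt_eqF //; move: cd2; lra.
have f4 : rising (i.+1%:R + k.+2%:R + c + d + 1) i.+1
    = T * (x + x + y + c + d + 3) * (x + x + y + c + d + 4) / (x + y + c + d + 3).
  apply: (mulfI h3); rewrite [RHS]mulrC divfK //.
  have eq2 : i.+1%:R + k.+2%:R + c + d + 1 = x + y + c + d + 3 + 1.
    by rewrite -!natr1 /x /y; ring.
  by rewrite eq2 -risingSl !risingSr -/T -natr1 -/x; ring.
have [hx [hy hy2]] : x + 1 != 0 /\ y + 1 != 0 /\ y + 2 != 0.
  by split; [|split]; rewrite gt_eqF //; lra.
have hf := (fact_neq0 i, fact_neq0 k).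
exists ((-1) ^+ i * S * T / ((i`!)%:R * (k`!)%:R)).
split; rewrite /jcoef ?e2 ?f1 ?f2 ?f3 ?f4 ?e1 ?risingSr -/S;
  rewrite ?factS_natr ?exprS -?[k.+1%:R]natr1 -/x -/y; field;
  by rewrite ?h3 ?hx ?hy ?hf //= ?hy2 ?hy ?h3 //=.
Qed.

(** The analogue at index j, which lies above the degree of the polynomial of
    degree j - 1. *)
Let jcoef_values_subtop i (x := i%:R : R) : exists W : R,
  [/\ jcoef i 1 = W * (c + x + 1),
      jcoef i.+1 0 = - W * (2 * x + c + d + 2) / (x + 1)
    & jcoef i.+1 1 = - W * (c + x + 2) * (2 * x + c + d + 2)
        * (2 * x + c + d + 3) / ((x + c + d + 2) * (x + 1))].
Proof.
have x0 : 0 <= x by rewrite ler0n.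
pose T := rising (x + c + d + 2) i.
have f1 : rising (i%:R + 1%:R + c + d + 1) i = T.
  by congr rising; rewrite /x; ring.
have f2 : rising (i.+1%:R + 0%:R + c + d + 1) i.+1 = T * (x + x + c + d + 2).
  have eq2 : i.+1%:R + 0%:R + c + d + 1 = x + c + d + 2.
    by rewrite -!natr1 /x; ring.
  by rewrite risingSr eq2 -/T -/x; ring.
have h3 : x + c + d + 2 != 0 by rewrite gt_eqF //; move: cd2; lra.
have f4 : rising (i.+1%:R + 1%:R + c + d + 1) i.+1
    = T * (x + x + c + d + 2) * (x + x + c + d + 3) / (x + c + d + 2).
  apply: (mulfI h3); rewrite [RHS]mulrC divfK //.
  have eq2 : i.+1%:R + 1%:R + c + d + 1 = x + c + d + 2 + 1.
    by rewrite -!natr1 /x; ring.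
  by rewrite eq2 -risingSl !risingSr -/T -natr1 -/x; ring.
have hx : x + 1 != 0 by rewrite gt_eqF //; lra.
have hf := fact_neq0 i.
exists ((-1) ^+ i * T / (i`!)%:R).
split; rewrite /jcoef ?f1 ?f2 ?f4 ?risingSr ?rising0;
  rewrite ?factS_natr ?exprS ?fact0 -?[i.+1%:R]natr1 -/x; field;
  by rewrite ?h3 ?hx ?hf.
Qed.

Let jcoef_value_top i (x := i%:R : R) : x + c + d + 1 != 0 ->
  jcoef i.+1 0 = - jcoef i 0 * (2 * x + c + d + 1) * (2 * x + c + d + 2)
                 / ((x + c + d + 1) * (x + 1)).
Proof.
move=> h3; have x0 : 0 <= x by rewrite ler0n.
pose T := rising (x + c + d + 1) i.
have f1 : rising (i%:R + 0%:R + c + d + 1) i = T.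
  by congr rising; rewrite /x; ring.
have f4 : rising (i.+1%:R + 0%:R + c + d + 1) i.+1
    = T * (x + x + c + d + 1) * (x + x + c + d + 2) / (x + c + d + 1).
  apply: (mulfI h3); rewrite [RHS]mulrC divfK //.
  have eq2 : i.+1%:R + 0%:R + c + d + 1 = x + c + d + 1 + 1.
    by rewrite -!natr1 /x; ring.
  by rewrite eq2 -risingSl !risingSr -/T -natr1 -/x; ring.
have hx : x + 1 != 0 by rewrite gt_eqF //; lra.
have hf := fact_neq0 i.
rewrite /jcoef f1 f4 ?rising0 factS_natr exprS fact0 -/x; field.
by rewrite ?h3 ?hx ?hf.
Qed.

Let jcoef_values_0 k (y := k%:R : R) :
  jcoef 0 k.+1 = jcoef 0 k * (c + y + 1) / (y + 1).
Proof.
have y0 : 0 <= y by rewrite ler0n.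
have hy : y + 1 != 0 by rewrite gt_eqF //; lra.
rewrite /jcoef !rising0 risingSr factS_natr expr0 -/y; field.
by rewrite hy !fact_neq0.
Qed.

Definition jpoly_coef j i : R := if (i <= j)%N then jcoef i (j - i) else 0.

Definition jpoly j : {poly R} := \poly_(i < j.+1) jpoly_coef j i.

Lemma coef_jpoly j i : (jpoly j)`_i = jpoly_coef j i.
Proof. by rewrite coef_poly ltnS /jpoly_coef; case: leqP. Qed.

Lemma jpoly_coefE i k j : (i + k)%N = j -> jpoly_coef j i = jcoef i k.
Proof. by move=> <-; rewrite /jpoly_coef leq_addr addKn. Qed.

Lemma jpoly_coef_gt j i : (j < i)%N -> jpoly_coef j i = 0.
Proof. by rewrite /jpoly_coef ltnNge => /negbTE ->. Qed.

(** In terms of the variable v = (1 - s) / 2 the factor A s - B is (A - B) - 2 A v. *)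
Lemma jpoly_coef_three_term j i : (1 <= j)%N ->
  jpoly_coef j.+1 i = (coefA c d j - Defs.coefB c d j) * jpoly_coef j i
    - 2 * coefA c d j * (if i is i'.+1 then jpoly_coef j i' else 0)
    - Defs.coefC c d j * jpoly_coef j.-1 i.
Proof.
case: j => // j _; rewrite succnK; have c2 := cd2.
case: i => [|i].
  have y0 : (0 : R) <= j%:R by rewrite ler0n.
  rewrite (jpoly_coefE (add0n j.+2)) (jpoly_coefE (add0n j.+1)) (jpoly_coefE (add0n j)).
  rewrite !jcoef_values_0 /coefA /Defs.coefB /Defs.coefC -![j.+1%:R]natr1.
  by field; do ?[apply/andP; split]; rewrite gt_eqF //; lra.
have x0 : (0 : R) <= i%:R by rewrite ler0n.
have [ij|ji|<-] := ltngtP i j.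
- pose k := (j - i.+1)%N; have y0 : (0 : R) <= k%:R by rewrite ler0n.
  have jE : j.+1%:R = i%:R + k%:R + 2 :> R.
    by rewrite -natrD -natrD; congr (_%:R); rewrite /k; lia.
  rewrite (jpoly_coefE (_ : i.+1 + k.+2 = j.+2)%N); last by rewrite /k; lia.
  rewrite (jpoly_coefE (_ : i.+1 + k.+1 = j.+1)%N); last by rewrite /k; lia.
  rewrite (jpoly_coefE (_ : i + k.+2 = j.+1)%N); last by rewrite /k; lia.
  rewrite (jpoly_coefE (_ : i.+1 + k = j)%N); last by rewrite /k; lia.
  have [W [-> -> -> ->]] := jcoef_values_inner i k.
  rewrite /coefA /Defs.coefB /Defs.coefC jE.
  by field; do ?[apply/andP; split]; rewrite gt_eqF //; lra.
- rewrite (jpoly_coef_gt (_ : j.+1 < i.+1)%N) // (jpoly_coef_gt (_ : j < i.+1)%N);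
    last exact: ltnW.
  have [->|ij] := eqVneq i j.+1.
    rewrite (jpoly_coefE (addn0 j.+2)) (jpoly_coefE (addn0 j.+1)).
    rewrite jcoef_value_top /coefA -![j.+1%:R]natr1; last first.
      by rewrite gt_eqF //; have := ler0n R j; lra.
    have y0 : (0 : R) <= j%:R by rewrite ler0n.
    by field; do ?[apply/andP; split]; rewrite gt_eqF //; lra.
  by rewrite !jpoly_coef_gt ?mulr0 ?subr0 //; lia.
- rewrite (jpoly_coefE (_ : i.+1 + 1 = i.+2)%N) ?addn1 //.
  rewrite (jpoly_coefE (addn0 i.+1)) (jpoly_coefE (addn1 i)) jpoly_coef_gt //.
  have [W [-> -> ->]] := jcoef_values_subtop i.
  rewrite /coefA /Defs.coefB /Defs.coefC -![i.+1%:R]natr1.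
  by field; do ?[apply/andP; split]; rewrite gt_eqF //; lra.
Qed.

(** The factor -1/2 is the derivative of (1 - s) / 2.  The denominator j + c + d
    of hatA can vanish only for j = 1, where hatA multiplies a coefficient above
    the degree. *)
Lemma jpoly_coef_deriv j i : (1 <= j)%N ->
  jpoly_coef j i = - (i.+1%:R / 2) *
    (hatA c d j * jpoly_coef j.-1 i.+1 + hatB c d j * jpoly_coef j i.+1
     + hatC c d j * jpoly_coef j.+1 i.+1).
Proof.
case: j => // j _; rewrite succnK; have c2 := cd2.
have x0 : (0 : R) <= i%:R by rewrite ler0n.
have [ij|ji] := ltnP i j.
  pose k := (j - i.+1)%N; have y0 : (0 : R) <= k%:R by rewrite ler0n.
  have jE : j.+1%:R = i%:R + k%:R + 2 :> R.
    by rewrite -natrD -natrD; congr (_%:R); rewrite /k; lia.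
  rewrite (jpoly_coefE (_ : i.+1 + k.+2 = j.+2)%N); last by rewrite /k; lia.
  rewrite (jpoly_coefE (_ : i.+1 + k.+1 = j.+1)%N); last by rewrite /k; lia.
  rewrite (jpoly_coefE (_ : i + k.+2 = j.+1)%N); last by rewrite /k; lia.
  rewrite (jpoly_coefE (_ : i.+1 + k = j)%N); last by rewrite /k; lia.
  have [W [-> -> -> ->]] := jcoef_values_inner i k.
  have j1 : (j.+1 == 1)%N = false by lia.
  rewrite /hatA /hatB /hatC j1 jE /= -[i.+1%:R]natr1.
  by field; do ?[apply/andP; split]; rewrite gt_eqF //; lra.
rewrite (jpoly_coef_gt (_ : j < i.+1)%N) // mulr0 add0r.
have [->|ij] := eqVneq i j.
  rewrite (jpoly_coefE (_ : j.+1 + 1 = j.+2)%N) ?addn1 //.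
  rewrite (jpoly_coefE (addn0 j.+1)) (jpoly_coefE (addn1 j)).
  have [W [-> -> ->]] := jcoef_values_subtop j.
  rewrite /hatB /hatC -![j.+1%:R]natr1.
  have y0 : (0 : R) <= j%:R by rewrite ler0n.
  by field; do ?[apply/andP; split]; rewrite gt_eqF //; lra.
rewrite (jpoly_coef_gt (_ : j.+1 < i.+1)%N); last by lia.
have [->|ij'] := eqVneq i j.+1.
  rewrite (jpoly_coefE (addn0 j.+2)) (jpoly_coefE (addn0 j.+1)).
  have y0 : (0 : R) <= j%:R by rewrite ler0n.
  have h3 : j.+1%:R + c + d + 1 != 0 by rewrite gt_eqF // -natr1; lra.
  rewrite (jcoef_value_top h3) /hatC.
  have -> : j.+2%:R = j%:R + 2 :> R by rewrite -[2]/(2%:R) -natrD addn2.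
  rewrite -![j.+1%:R]natr1.
  by field; do ?[apply/andP; split]; rewrite gt_eqF //; lra.
by rewrite !jpoly_coef_gt ?mulr0 ?addr0 ?mulr0 //; lia.
Qed.

End JacobiCoefficients.

(** * Orthogonality through the hypergeometric operator *)

Section Hypergeometric.
Variables (R : realType) (c d : R).
Hypotheses (hc : -1 < c) (hd : -1 < d).
Implicit Types (i j k n : nat) (f g p q : {poly R}).

Local Notation mu := (@lebesgue_measure R).
Local Notation jpoly := (jpoly c d).
Local Notation jpoly_coef := (jpoly_coef c d).

Let cd2 : - 2 < c + d.
Proof. by move: hc hd; lra. Qed.

(** The hypergeometric operator, which is the Jacobi differential operator
    written in the variable (1 - s) / 2. *)
Definition hypergeo f : {poly R} :=
  'X * (1 - 'X) * f^`()^`() + ((c + 1)%:P - (c + d + 2) *: 'X) * f^`().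

Lemma coef_hypergeo f i : (hypergeo f)`_i =
  (i%:R + 1) * (i%:R + c + 1) * f`_i.+1 - i%:R * (i%:R + c + d + 1) * f`_i.
Proof.
have -> : hypergeo f = 'X * f^`()^`() - 'X * ('X * f^`()^`())
    + ((c + 1) *: f^`() - (c + d + 2) *: ('X * f^`())).
  by rewrite /hypergeo -!mul_polyC; ring.
have dE h n : (h^`())`_n = (n%:R + 1) * h`_n.+1 by rewrite coef_deriv natr1 mulr_natl.
case: i => [|[|i]]; rewrite !(coefD, coefN, coefXM, coefZ, dE) /=; first by ring.
  by ring.
by rewrite -[i.+2%:R]natr1 -[i.+1%:R]natr1; ring.
Qed.

Definition hyperval j : R := j%:R * (j%:R + c + d + 1).

Lemma hyperval_neq n j : (n < j)%N -> hyperval j - hyperval n != 0.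
Proof.
move=> nj; have -> : hyperval j - hyperval n
    = (j%:R - n%:R) * (j%:R + n%:R + c + d + 1) by rewrite /hyperval; ring.
have n0 : (0 : R) <= n%:R by rewrite ler0n.
have j1 : n%:R + 1 <= j%:R :> R by rewrite natr1 ler_nat.
by rewrite mulf_neq0 // gt_eqF //; move: cd2; lra.
Qed.

Lemma hypergeo_jpoly j : hypergeo (jpoly j) = - hyperval j *: jpoly j.
Proof.
apply/polyP => i; rewrite coef_hypergeo coefZ !coef_jpoly.
have [ij|ji] := ltnP i j; last first.
  rewrite (@jpoly_coef_gt _ _ _ j i.+1) // mulr0 sub0r.
  have [->|ij] := eqVneq i j; first by rewrite mulNr.
  by rewrite jpoly_coef_gt ?mulr0 ?oppr0 //; lia.
pose k := (j - i.+1)%N.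
rewrite (jpoly_coefE _ _ (_ : i.+1 + k = j)%N); last by rewrite /k; lia.
rewrite (jpoly_coefE _ _ (_ : i + k.+1 = j)%N); last by rewrite /k; lia.
have jE : j%:R = i%:R + k%:R + 1 :> R.
  by rewrite -natrD natr1; congr (_%:R); rewrite /k; lia.
have i0 : i%:R + 1 != 0 :> R by rewrite natr1 pnatr_eq0.
have k0 : k%:R + 1 != 0 :> R by rewrite natr1 pnatr_eq0.
have f0 n : (n`!)%:R != 0 :> R by rewrite pnatr_eq0 -lt0n fact_gt0.
have fS n : ((n.+1)`!)%:R = (n%:R + 1) * (n`!)%:R :> R by rewrite factS natrM -natr1.
have e1 : c + i.+1%:R + 1 = c + i%:R + 1 + 1 by rewrite -natr1; ring.
have e2 : i.+1%:R + k%:R + c + d + 1 = i%:R + k%:R + 1 + c + d + 1 by rewrite -natr1; ring.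
rewrite /hyperval /jcoef jE (risingSl _ k) e1 e2 -[k.+1%:R]natr1 (risingSr _ i) !fS exprS.
have -> : i%:R + (k%:R + 1) + c + d + 1 = i%:R + k%:R + 1 + c + d + 1 by ring.
field.
by rewrite i0 k0 !f0.
Qed.

Lemma jpoly_neq0_top j : jpoly_coef j j != 0.
Proof.
rewrite (jpoly_coefE _ _ (addn0 j)) /jcoef rising0 mulr1.
have f0 n : (n`!)%:R != 0 :> R by rewrite pnatr_eq0 -lt0n fact_gt0.
rewrite !(mulf_eq0, invr_eq0) (negbTE (f0 j)) (negbTE (f0 0)) signr_eq0 /= orbF.
apply/prodf_neq0 => i _; case: j i => [|j] i; first by case: i.
rewrite gt_eqF // -natr1; move: (ler0n R i) (ler0n R j) cd2; lra.
Qed.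

Lemma size_jpoly j : size (jpoly j) = j.+1.
Proof. by apply: size_poly_eq; exact: jpoly_neq0_top. Qed.

Definition uvar : {poly R} := 2^-1 *: (1 - 'X).

Definition uint f : R := jint (-1) 1 c d (f \Po uvar).

Let m11 : (-1 : R) < 1. Proof. by lra. Qed.

Lemma uintD f g : uint (f + g) = uint f + uint g.
Proof. by rewrite /uint comp_polyD jintD. Qed.

Lemma uintZ (t : R) f : uint (t *: f) = t * uint f.
Proof. by rewrite /uint comp_polyZ jintZ. Qed.

Let comp_uvar1 : 1 \Po uvar = 1.
Proof. by rewrite -polyC1 comp_polyC. Qed.

(** The Pearson polynomial of f((1 - s) / 2) is -2 times the integrand here: one
    factor -1/2 comes from the chain rule, and (1 - s) (1 + s) = 4 v (1 - v) for
    v = (1 - s) / 2. *)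
Lemma uint_pearson f :
  uint ('X * (1 - 'X) * f^`() + ((c + 1)%:P - (c + d + 2) *: 'X) * f) = 0.
Proof.
have jp := jint_pearson m11 hc hd (f \Po uvar).
apply: (mulfI (_ : (-2 : R) != 0)); first by rewrite oppr_eq0 pnatr_eq0.
rewrite mulr0 -uintZ -[RHS]jp /uint; congr jint.
have e2 : (2 : R)%:P = 2 by rewrite rmorph_nat.
have h2 : 2 * (2^-1)%:P = 1 :> {poly R} by rewrite -e2 -polyCM mulfV ?pnatr_eq0.
have XE : 'X = 1 - 2 * uvar :> {poly R}.
  by rewrite /uvar -mul_polyC mulrA h2 mul1r subKr.
rewrite /pearson deriv_comp /uvar derivZ derivB derivX derivC -/uvar.
rewrite comp_polyZ comp_polyD !comp_polyM !comp_polyB comp_polyX comp_polyZ.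
rewrite comp_polyX !comp_polyC.
set F := f \Po _; set F' := f^`() \Po _; rewrite -!mul_polyC XE.
rewrite ?e2 !(polyCD, polyCN, polyC1).
move: h2; set h := (2^-1)%:P => h2.
have FE : F' = 2 * h * F' by rewrite h2 mul1r.
by rewrite [in LHS]FE; ring.
Qed.

(** The difference of the two integrands is the integrand of the Pearson identity
    for the Wronskian f' g - f g'. *)
Lemma uint_hypergeo_sym f g : uint (hypergeo f * g) = uint (f * hypergeo g).
Proof.
apply/eqP; rewrite -subr_eq0 -(uint_pearson (f^`() * g - f * g^`())).
have -> : uint (hypergeo f * g) - uint (f * hypergeo g)
    = uint (hypergeo f * g - f * hypergeo g).
  by rewrite uintD -[- (f * _)]scaleN1r uintZ mulN1r.
apply/eqP; congr uint; rewrite /hypergeo derivB !derivM; ring.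
Qed.

(** Induction on the degree n of g.  Modulo lower degree g is an eigenvector of
    the operator for the eigenvalue of index n, so symmetry gives
    (hyperval j - hyperval n) times the integral = 0. *)
Lemma uint_jpoly_orth j g : (size g <= j)%N -> uint (jpoly j * g) = 0.
Proof.
move: {2}(size g) (leqnn (size g)) => n; elim: n g => [|n IHn] g gn gj.
  move: gn; rewrite leqn0 size_poly_eq0 => /eqP ->; rewrite mulr0.
  by rewrite -(scale0r 0) uintZ mul0r.
have [gn'|] := leqP (size g) n; first exact: IHn.
move=> ng; have nj : (n < j)%N by exact: leq_trans ng gj.
have gS : size g = n.+1 by apply/eqP; rewrite eqn_leq gn ng.
have hn : (size (hypergeo g + hyperval n *: g)%R <= n)%N.
  apply/leq_sizeP => i ni; rewrite coefD coefZ coef_hypergeo.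
  rewrite [g`_i.+1]nth_default ?gS ?ltnS // mulr0 sub0r.
  have [->|ni'] := eqVneq i n; first by rewrite /hyperval addrC subrr.
  by rewrite [g`_i]nth_default ?mulr0 ?oppr0 ?addr0 // gS ltn_neqAle eq_sym ni' ni.
have := IHn _ hn (leq_trans hn (ltnW nj)).
rewrite mulrDr uintD -uint_hypergeo_sym hypergeo_jpoly -scalerAl uintZ.
rewrite -scalerAr uintZ -mulrDl => /eqP; rewrite mulf_eq0 => /orP[|/eqP //].
by rewrite addrC -oppr_eq0 opprB (negbTE (hyperval_neq nj)).
Qed.

Definition jacobi_poly j : {poly R} := jpoly j \Po uvar.

Lemma size_uvar : size uvar = 2.
Proof.
rewrite /uvar size_scale ?invr_eq0 ?pnatr_eq0 //.
by rewrite -size_polyN opprB size_XsubC.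
Qed.

Lemma jint_jacobi_poly_orth j q : (size q <= j)%N ->
  jint (-1) 1 c d (jacobi_poly j * q) = 0.
Proof.
move=> qj; pose v : {poly R} := 1 - 2 *: 'X.
have vK : v \Po uvar = 'X.
  rewrite /v comp_polyB comp_polyZ comp_polyX comp_uvar1 /uvar.
  by rewrite scalerA mulfV ?pnatr_eq0 // scale1r subKr.
have -> : q = (q \Po v) \Po uvar by rewrite -comp_polyA vK comp_polyXr.
rewrite /jacobi_poly -comp_polyM; apply: uint_jpoly_orth.
rewrite size_comp_poly2 // /v -size_polyN opprB.
by rewrite size_addl ?size_scale ?pnatr_eq0 // ?size_polyX // size_polyN size_polyC oner_neq0.
Qed.

End Hypergeometric.

(** * Jacobi polynomials and their relations *)

Section JacobiCharacterization.
Variables (R : realType) (c d : R).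
Hypotheses (hc : -1 < c) (hd : -1 < d).
Implicit Types (i j k n : nat) (p q : {poly R}).

Local Notation mu := (@lebesgue_measure R).
Local Notation jacobi_poly := (jacobi_poly c d).
Local Notation wint := (jint (-1) 1 c d).

Let m11 : (-1 : R) < 1. Proof. by lra. Qed.

Let wintE p q : wint (p * q) = \int[mu]_(s in `]-1, 1[)
  (p.[s] * q.[s] * ((1 - s) `^ c * (1 + s) `^ d)).
Proof.
by apply: eq_Rintegral => s _; rewrite hornerM /jweight opprK [s + 1]addrC.
Qed.

(** A nonzero q cannot vanish at size q distinct points; the points 1/(i+2) serve,
    as they lie inside the interval. *)
Lemma wint_sqr_eq0 q : wint (q * q) = 0 -> q = 0.
Proof.
move=> q0; apply/eqP/contraT => qn0.
pose s := [seq (i.+2%:R : R)^-1 | i <- iota 0 (size q)].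
have us : uniq s.
  rewrite map_inj_uniq ?iota_uniq // => i k /invr_inj/eqP.
  by rewrite eqr_nat => /eqP [].
have : ~~ all (root q) s.
  apply/negP => rs; have := max_poly_roots qn0 rs us.
  by rewrite size_map size_iota ltnn.
case/allPn => _ /mapP[i _ ->] ri; suff : 0 < wint (q * q) by rewrite q0 ltxx.
have xi : -1 < (i.+2%:R : R)^-1 < 1.
  by rewrite (lt_trans (ltrN10 _)) ?invr_gt0 ?ltr0n //= invf_lt1 ?ltr1n ?ltr0n.
apply: (@Rintegral_gt0 _ _ _ (i.+2%:R)^-1).
- exact: interval_open.
- by rewrite /= in_itv.
- apply: cvgM; first exact: continuous_horner.
  exact: continuous_jweight.
- by move=> x _; rewrite hornerM -expr2 mulr_ge0 ?sqr_ge0 ?jweight_ge0.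
- exact: integrable_poly_jweight.
- rewrite hornerM -expr2 mulr_gt0 ?jweight_gt0 //.
  by rewrite lt_def sqrf_eq0 ri sqr_ge0.
Qed.

Lemma Gamma_rising (x : R) n : 0 < x -> Gamma (x + n%:R) = rising x n * Gamma x.
Proof.
move=> x0; elim: n => [|n IHn]; first by rewrite addr0 rising0 mul1r.
rewrite -natr1 addrA GammaD1; first by rewrite IHn risingSr; ring.
by rewrite gt_eqF // ltr_wpDr.
Qed.

Lemma jacobi_poly1 j : (jacobi_poly j).[1] = rising (c + 1) j / (j`!)%:R.
Proof.
rewrite /jacobi_poly horner_comp /uvar !hornerE subrr mulr0 horner_coef0.
rewrite coef_jpoly (jpoly_coefE _ _ (add0n j)) /jcoef rising0 addr0 expr0 fact0.
by rewrite mul1r mulr1 mul1r.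
Qed.

Lemma jacobi_poly_is_jacobi j : is_jacobi c d j (jacobi_poly j).
Proof.
have c1 : 0 < c + 1 by move: hc; lra.
split.
- by rewrite size_comp_poly2 ?size_jpoly // size_uvar.
- by move=> q qj; rewrite -wintE jint_jacobi_poly_orth.
- rewrite jacobi_poly1 -addrA addrC Gamma_rising //.
  by field; rewrite gt_eqF ?Gamma_gt0 //= pnatr_eq0 -lt0n fact_gt0.
Qed.

(** Cancelling leading terms gives a polynomial of degree less than j which is a
    combination of p and q, hence orthogonal to itself; the nonzero value at 1
    then fixes the scaling. *)
Lemma is_jacobi_unique j p q : is_jacobi c d j p -> is_jacobi c d j q -> p = q.
Proof.
have c1 : 0 < c + 1 by move: hc; lra.
move=> [sp op ep] [sq oq eq].
pose r := lead_coef q *: p - lead_coef p *: q.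
have sr : (size r <= j)%N.
  apply/leq_sizeP => i ji; rewrite coefB !coefZ.
  have [->|ij] := eqVneq i j.
    by rewrite /lead_coef sp sq /= mulrC subrr.
  rewrite !nth_default ?mulr0 ?subrr //; by rewrite ?sp ?sq ltn_neqAle eq_sym ij ji.
have r0 : r = 0.
  apply: wint_sqr_eq0; rewrite {1}/r mulrBl -!scalerAl.
  by rewrite jintB // !jintZ // !wintE op // oq // !mulr0 subr0.
have pn0 : lead_coef p != 0 by rewrite lead_coef_eq0 -size_poly_eq0 sp.
have e1 : p.[1] != 0.
  rewrite ep mulf_neq0 ?invr_eq0 ?mulf_neq0 ?pnatr_eq0 -?lt0n ?fact_gt0 //.
    by rewrite gt_eqF // Gamma_gt0 // -addrA ltr_wpDl.
  by rewrite gt_eqF // Gamma_gt0.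
have lE : lead_coef p = lead_coef q.
  have : r.[1] = 0 by rewrite r0 horner0.
  rewrite /r hornerD hornerN !hornerZ ep -eq => /eqP.
  by rewrite eq -ep -mulrBl mulf_eq0 (negbTE e1) orbF subr_eq0 => /eqP.
move: r0; rewrite /r -lE -scalerBr => /eqP; rewrite scaler_eq0 (negbTE pn0) /=.
by rewrite subr_eq0 => /eqP.
Qed.

Lemma jacobiE j : jacobi c d j = jacobi_poly j.
Proof.
apply: is_jacobi_unique (jacobi_poly_is_jacobi j).
rewrite /jacobi; case: xgetP => [p -> //|/(_ (jacobi_poly j))].
by case; exact: jacobi_poly_is_jacobi.
Qed.

Lemma jacobi_three_term j : (1 <= j)%N -> jacobi c d j.+1 =
  (coefA c d j *: 'X - (Defs.coefB c d j)%:P) * jacobi c d j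
  - Defs.coefC c d j *: jacobi c d j.-1.
Proof.
move=> j1; rewrite !jacobiE /jacobi_poly.
have -> : coefA c d j *: 'X - (Defs.coefB c d j)%:P
    = ((coefA c d j - Defs.coefB c d j)%:P - (2 * coefA c d j) *: 'X) \Po uvar R.
  rewrite comp_polyB comp_polyZ comp_polyX comp_polyC /uvar polyCB.
  rewrite scalerA mulrAC mulfV ?pnatr_eq0 // mul1r scalerBr alg_polyC.
  by rewrite opprB [RHS]addrC addrA addrNK.
rewrite -comp_polyM -comp_polyZ -comp_polyB; congr (_ \Po _).
apply/polyP => i; rewrite mulrBl mul_polyC -scalerAl coefB coefB.
rewrite !coefZ coefXM !coef_jpoly jpoly_coef_three_term //.
by case: i.
Qed.

Lemma jacobi_deriv j : (1 <= j)%N -> jacobi c d j =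
  (hatA c d j *: jacobi c d j.-1 + hatB c d j *: jacobi c d j
   + hatC c d j *: jacobi c d j.+1)^`().
Proof.
move=> j1; rewrite !jacobiE /jacobi_poly -!comp_polyZ -!comp_polyD deriv_comp.
have -> : (uvar R)^`() = (- 2^-1)%:P.
  by rewrite /uvar derivZ derivB derivX -polyC1 derivC sub0r scalerN alg_polyC polyCN.
rewrite mulrC mul_polyC -comp_polyZ; congr (_ \Po _).
apply/polyP => i; rewrite coefZ coef_deriv !coefD !coefZ !coef_jpoly.
rewrite jpoly_coef_deriv // -mulr_natr; ring.
Qed.

Lemma jacobi0 : jacobi c d 0 = 1.
Proof.
rewrite jacobiE /jacobi_poly (_ : jpoly c d 0 = 1%:P) ?comp_polyC //.
apply/polyP => i; rewrite coef_jpoly coefC; case: i => [|i]; last by rewrite jpoly_coef_gt.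
by rewrite (jpoly_coefE _ _ (add0n 0)) /jcoef !rising0 expr0 fact0; field.
Qed.

Lemma jacobi1 : jacobi c d 1 =
  ((jacobi c d 1).[-1])%:P + ((c + d + 2) / 2) *: ('X + 1).
Proof.
suff [b ->] : exists b, jacobi c d 1 = b%:P + ((c + d + 2) / 2) *: ('X + 1).
  by rewrite !hornerE addNr mulr0 addr0.
exists (c + 1 - (c + d + 2)); rewrite jacobiE /jacobi_poly.
have -> : jpoly c d 1 = (c + 1)%:P - (c + d + 2) *: 'X.
  apply/polyP => i; rewrite coef_jpoly coefB coefC coefZ coefX.
  case: i => [|[|i]] /=; last by rewrite jpoly_coef_gt // mulr0 subr0.
    by rewrite (jpoly_coefE _ _ (add0n 1)) /jcoef risingSr !rising0 !factS fact0; field.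
  by rewrite (jpoly_coefE _ _ (addn0 1)) /jcoef risingSr !rising0 !factS fact0; field.
rewrite comp_polyB comp_polyZ comp_polyX comp_polyC /uvar scalerA.
rewrite polyCB -!mul_polyC.
have e2 : (c + d + 2)%:P = 2 * ((c + d + 2) / 2)%:P :> {poly R}.
  have p2 : (2 : R)%:P = 2 by rewrite rmorph_nat.
  by rewrite -p2 -polyCM mulrC divfK ?pnatr_eq0.
rewrite e2; ring.
Qed.

End JacobiCharacterization.

(** * Fractional integrals of polynomials *)

Section CoefficientSums.
Variable R : realType.
Implicit Types (g : nat -> R) (p q : {poly R}).

Definition coef_sum g q : R := \sum_(i < size q) q`_i * g i.

Lemma coef_sum_widen g q n : (size q <= n)%N ->
  coef_sum g q = \sum_(i < n) q`_i * g i.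
Proof.
move=> qn; rewrite /coef_sum (big_ord_widen n (fun i => q`_i * g i)) //.
rewrite big_mkcond; apply: eq_bigr => i _; case: ltnP => // qi.
by rewrite nth_default ?mul0r.
Qed.

Lemma coef_sumD g p q : coef_sum g (p + q) = coef_sum g p + coef_sum g q.
Proof.
pose n := maxn (size p) (size q).
rewrite !(@coef_sum_widen _ _ n) ?leq_maxl ?leq_maxr ?size_polyD //.
by rewrite -big_split; apply: eq_bigr => i _; rewrite coefD mulrDl.
Qed.

Lemma coef_sumZ g (t : R) q : coef_sum g (t *: q) = t * coef_sum g q.
Proof.
rewrite (coef_sum_widen g (size_scale_leq t q)) /coef_sum mulr_sumr.
by apply: eq_bigr => i _; rewrite coefZ mulrA.
Qed.

Lemma coef_sumC g (t : R) : coef_sum g t%:P = t * g 0.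
Proof.
by rewrite (@coef_sum_widen _ _ 1) ?size_polyC_leq1 // big_ord1 coefC.
Qed.

Lemma coef_sumXM g q : coef_sum g ('X * q) = coef_sum (fun i => g i.+1) q.
Proof.
rewrite (@coef_sum_widen _ _ (size q).+1); last first.
  by rewrite (leq_trans (size_mul_leq _ _)) // size_polyX.
rewrite big_ord_recl coefXM mul0r add0r; apply: eq_bigr => i _.
by rewrite lift0 coefXM.
Qed.

Lemma coef_sum_deriv g q :
  coef_sum g q^`() = coef_sum (fun i => i%:R * g i.-1) q.
Proof.
rewrite (coef_sum_widen _ (leqnSn (size q))) (@coef_sum_widen _ _ (size q)).
  rewrite big_ord_recl mul0r mulr0 add0r; apply: eq_bigr => i _.
  by rewrite lift0 coef_deriv mulr_natl mulrnAl mulrnAr.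
apply/leq_sizeP => i qi; rewrite coef_deriv nth_default ?mul0rn //.
exact: leqW.
Qed.

Lemma eq_coef_sum g g' q : g =1 g' -> coef_sum g q = coef_sum g' q.
Proof. by move=> gg; apply: eq_bigr => i _; rewrite gg. Qed.

Lemma coef_sum_lin g g' (t t' : R) q :
  coef_sum (fun i => t * g i + t' * g' i) q = t * coef_sum g q + t' * coef_sum g' q.
Proof.
rewrite /coef_sum !mulr_sumr -big_split; apply: eq_bigr => i _ /=; ring.
Qed.

End CoefficientSums.

Section FractionalIntegral.
Variables (R : realType) (u : R).
Hypotheses (u0 : 0 < u) (u1 : u < 1).
Implicit Types (p q : {poly R}) (x z : R) (i n m : nat).

Local Notation mu := (@lebesgue_measure R).

(** The n-th derivative at x = z + 1 of the fractional integral of order u of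
    (s + 1)^i. *)
Definition frac_kernel n x i : R :=
  (i`!)%:R / Gamma (u + i%:R + 1 - n%:R) * x `^ (u + i%:R - n%:R).

(** Composition with X - 1 reads off the coefficients of p in powers of s + 1. *)
Definition frac_deriv n p x : R := coef_sum (frac_kernel n x) (p \Po ('X - 1)).

Let u_nint i n : u + i%:R - n%:R != 0.
Proof.
apply/eqP => h; have [ni|inn] := leqP n i.
  have : (n%:R : R) <= i%:R by rewrite ler_nat.
  by move: u0 h; lra.
have : (i%:R : R) + 1 <= n%:R by rewrite natr1 ler_nat.
by move: u1 h; lra.
Qed.

Let powRS x e : 0 < x -> x `^ (e + 1) = x * x `^ e.
Proof.
by move=> x0; rewrite powRD ?(gt_eqF x0) ?implybT // powRr1 ?ltW // mulrC.
Qed.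

(** The functional equation of Gamma may be used at u + i - n, which is never an
    integer because 0 < u < 1. *)
Lemma invGamma i n :
  (Gamma (u + i%:R - n%:R))^-1 = (u + i%:R - n%:R) / Gamma (u + i%:R + 1 - n%:R).
Proof.
have -> : u + i%:R + 1 - n%:R = u + i%:R - n%:R + 1 by ring.
by rewrite GammaD1 // invfM mulVKf.
Qed.

Lemma frac_kernel_succ n x i : 0 < x ->
  frac_kernel n.+1 x i.+1 = x * frac_kernel n.+1 x i + (n.+1%:R - u) * frac_kernel n x i.
Proof.
move=> x0; rewrite /frac_kernel factS natrM.
have -> : u + i.+1%:R + 1 - n.+1%:R = u + i%:R + 1 - n%:R by rewrite -!natr1; ring.
have -> : u + i%:R + 1 - n.+1%:R = u + i%:R - n%:R by rewrite -!natr1; ring.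
have -> : u + i.+1%:R - n.+1%:R = u + i%:R - n%:R by rewrite -!natr1; ring.
have -> : u + i%:R - n%:R = u + i%:R - n.+1%:R + 1 by rewrite -natr1; ring.
rewrite powRS // -[u + i%:R - n.+1%:R + 1](_ : u + i%:R - n%:R = _); last first.
  by rewrite -natr1; ring.
rewrite invGamma -!natr1; ring.
Qed.

Lemma frac_kernel_shift n x i :
  i.+1%:R * frac_kernel n x i = frac_kernel n.+1 x i.+1.
Proof.
rewrite /frac_kernel factS natrM.
have -> : u + i.+1%:R + 1 - n.+1%:R = u + i%:R + 1 - n%:R by rewrite -!natr1; ring.
have -> : u + i.+1%:R - n.+1%:R = u + i%:R - n%:R by rewrite -!natr1; ring.
by rewrite !mulrA.
Qed.

Lemma frac_derivD n p q x : frac_deriv n (p + q) x = frac_deriv n p x + frac_deriv n q x.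
Proof. by rewrite /frac_deriv comp_polyD coef_sumD. Qed.

Lemma frac_derivZ n (t : R) p x : frac_deriv n (t *: p) x = t * frac_deriv n p x.
Proof. by rewrite /frac_deriv comp_polyZ coef_sumZ. Qed.

Lemma frac_derivC n (t : R) x : frac_deriv n t%:P x = t * frac_kernel n x 0.
Proof. by rewrite /frac_deriv comp_polyC coef_sumC. Qed.

Let shiftX : ('X + 1) \Po ('X - 1) = 'X :> {poly R}.
Proof.
by rewrite comp_polyD comp_polyX -[X in X \Po _]polyC1 comp_polyC polyC1 subrK.
Qed.

Lemma frac_derivX1 n x : frac_deriv n ('X + 1) x = frac_kernel n x 1.
Proof. by rewrite /frac_deriv shiftX -['X]mulr1 coef_sumXM -polyC1 coef_sumC mul1r. Qed.

(** The Leibniz rule gives n + 1 and the raised order of the kernel gives - u: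
    the fractional integral of order u + 1 of p has frac_deriv n p as its
    derivative of order n + 1. *)
Lemma frac_deriv_mulX1 n p x : 0 < x -> frac_deriv n.+1 (('X + 1) * p) x =
  x * frac_deriv n.+1 p x + (n.+1%:R - u) * frac_deriv n p x.
Proof.
move=> x0; rewrite /frac_deriv comp_polyM shiftX coef_sumXM -coef_sum_lin.
by apply: eq_coef_sum => i; exact: frac_kernel_succ.
Qed.

(** Integration by parts; the boundary term at -1 is the monomial i = 0, which
    differentiation of p kills. *)
Lemma frac_deriv_of_deriv n p x :
  frac_deriv n p^`() x = frac_deriv n.+1 p x - p.[-1] * frac_kernel n.+1 x 0.
Proof.
rewrite /frac_deriv; set q := p \Po ('X - 1).
have -> : p^`() \Po ('X - 1) = q^`().
  by rewrite deriv_comp derivB derivX -polyC1 derivC subr0 mulr1.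
have -> : p.[-1] = q`_0.
  by rewrite -horner_coef0 /q horner_comp !hornerE.
rewrite coef_sum_deriv !(coef_sum_widen _ (leqnSn (size q))) !big_ord_recl.
rewrite mul0r mulr0 add0r addrAC subrr add0r; apply: eq_bigr => i _.
by rewrite lift0 frac_kernel_shift.
Qed.

Lemma is_derive_frac_kernel n i z : -1 < z ->
  is_derive z 1 (fun t => frac_kernel n (t + 1) i) (frac_kernel n.+1 (z + 1) i).
Proof.
move=> z1; rewrite /frac_kernel.
have dp := is_derive_powR_right (u + i%:R - n%:R) z1.
pose K := (i`!)%:R / Gamma (u + i%:R + 1 - n%:R).
have -> : (fun t => K * (t + 1) `^ (u + i%:R - n%:R))
    = (K \*: (fun s : R => (s - -1) `^ (u + i%:R - n%:R))).
  by apply/funext => t; rewrite opprK.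
apply: (is_derive_eq (is_deriveZ K dp)); rewrite /GRing.scale /= opprK /K.
have -> : u + i%:R - n.+1%:R = u + i%:R - n%:R - 1 by rewrite -natr1; ring.
have -> : u + i%:R + 1 - n.+1%:R = u + i%:R - n%:R by rewrite -natr1; ring.
by rewrite invGamma; ring.
Qed.

Lemma is_derive_frac_deriv n p z : -1 < z ->
  is_derive z 1 (fun t => frac_deriv n p (t + 1)) (frac_deriv n.+1 p (z + 1)).
Proof.
move=> z1; rewrite /frac_deriv; set q := p \Po _.
have -> : (fun t => coef_sum (frac_kernel n (t + 1)) q)
    = \sum_(i < size q) (q`_i \*: (fun t => frac_kernel n (t + 1) i)).
  by apply/funext => t; rewrite fct_sumE.
apply: is_derive_sum => i; apply: is_deriveZ; exact: is_derive_frac_kernel.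
Qed.

Let um1 : -1 < u - 1. Proof. by move: u0; lra. Qed.
Let d0 : (-1 : R) < 0. Proof. by lra. Qed.

(** The Pearson identity for (s + 1)^i relates the integrals of (s + 1)^i and
    (s + 1)^(i+1), so induction on i reduces everything to the integral of
    (z - s)^(u-1). *)
Lemma jint_frac_monomial z i : -1 < z ->
  jint (-1) z (u - 1) 0 (('X + 1) ^+ i) = Gamma u * frac_kernel 0 (z + 1) i.
Proof.
move=> z1; have z0 : 0 < z + 1 by lra.
have un n : u + n%:R != 0 by rewrite gt_eqF // ltr_wpDr.
elim: i => [|i IHi].
  rewrite expr0 /jint.
  under eq_Rintegral do rewrite hornerC mul1r /jweight powRr0 mulr1.
  rewrite Rintegral_powR_left // subrK opprK /frac_kernel addr0 fact0 subr0 subr0.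
  rewrite GammaD1 ?gt_eqF //; field.
  by rewrite gt_eqF ?Gamma_gt0 // gt_eqF.
have := jint_pearson z1 um1 d0 (('X + 1) ^+ i).
have -> : pearson (-1) z (u - 1) 0 (('X + 1) ^+ i) =
    ((i%:R + 1) * (z + 1)) *: ('X + 1) ^+ i - (i%:R + 1 + u) *: ('X + 1) ^+ i.+1.
  have XE : z%:P - 'X = (z + 1)%:P - ('X + 1) by rewrite polyCD polyC1; ring.
  have XE' : 'X - (-1)%:P = 'X + 1 :> {poly R} by rewrite polyCN polyC1 opprK.
  have dE : ('X + 1) * (('X + 1) ^+ i)^`() = i%:R * ('X + 1) ^+ i :> {poly R}.
    have d1 : ('X + 1)^`() = 1 :> {poly R} by rewrite derivD derivX -polyC1 derivC addr0.
    rewrite deriv_exp d1 mul1r mulrnAr -exprS mulr_natl.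
    by case: i {IHi} => [|i]; rewrite ?mulr0n.
  rewrite /pearson XE XE' add0r subrK scale1r -mulrA dE exprS -!mul_polyC.
  have iE : (i%:R : R)%:P = i%:R by rewrite rmorph_nat.
  by rewrite !(polyCM, polyCD, polyC1) iE; ring.
rewrite jintB // !jintZ // IHi => /eqP; rewrite subr_eq0 => /eqP e.
have h : i%:R + 1 + u != 0 by rewrite gt_eqF // ltr_wpDl // addr_ge0.
apply: (mulfI h); rewrite -e /frac_kernel !subr0 factS natrM.
have -> : u + i.+1%:R + 1 = u + i%:R + 1 + 1 by rewrite -natr1; ring.
have -> : u + i.+1%:R = u + i%:R + 1 by rewrite -natr1; ring.
have un1 : u + i%:R + 1 != 0 by rewrite -addrA natr1.
rewrite (GammaD1 un1) (powRS _ z0) -natr1; field.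
by rewrite un1 andbT gt_eqF // Gamma_gt0 // addr_gt0 // ltr_wpDr.
Qed.

Lemma jint_frac p z : -1 < z ->
  (Gamma u)^-1 * jint (-1) z (u - 1) 0 p = frac_deriv 0 p (z + 1).
Proof.
move=> z1; rewrite /frac_deriv; set q := p \Po _.
have -> : p = q \Po ('X + 1).
  rewrite /q -comp_polyA comp_polyB comp_polyX -[X in _ - (X \Po _)]polyC1.
  by rewrite comp_polyC polyC1 addrK comp_polyXr.
have j0 : jint (-1) z (u - 1) 0 0 = 0 
  by rewrite -[X in jint _ _ _ _ X](scale0r (0 : {poly R})) jintZ // mul0r.
rewrite comp_polyE (big_morph _ (jintD z1 um1 d0) j0) mulr_sumr.
apply: eq_bigr => i _; rewrite jintZ // jint_frac_monomial // mulrCA mulKf //.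
by rewrite gt_eqF // Gamma_gt0.
Qed.

(** Each derivative is known on the whole open half-line z > -1, hence near every
    of its points, so it can be differentiated once more. *)
Lemma derive1n_frac (f : R -> R) p :
  (forall z, -1 < z -> f z = frac_deriv 0 p (z + 1)) ->
  forall n z, -1 < z -> derivable (derive1n n f) z 1 /\
    derive1n n f z = frac_deriv n p (z + 1).
Proof.
move=> fE n; have derivS k : (forall z, -1 < z -> derive1n k f z = frac_deriv k p (z + 1)) ->
    forall z, -1 < z -> is_derive z 1 (derive1n k f) (frac_deriv k.+1 p (z + 1)).
  move=> fk z z1; apply: (near_eq_is_derive _ (is_derive_frac_deriv k p z1)).
  by near=> t; apply/esym; apply: fk; near: t; exact: lt_nbhsr.
have vals k : forall z, -1 < z -> derive1n k f z = frac_deriv k p (z + 1).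
  elim: k => [|k IHk] z z1; first exact: fE.
  by rewrite derive1nS derive1E; have [_ ->] := derivS k IHk z z1.
by move=> z z1; split; [have [] := derivS n (vals n) z z1|exact: vals].
Unshelve. all: by end_near. Qed.

End FractionalIntegral.

(** * The recurrence *)

Lemma Rhat_frac (R : realType) (k : nat) (c d beta : R) (j : nat) (z : R) :
  k%:R - 1 < beta -> beta < k%:R -> -1 < z ->
  Rhat k c d beta j z = frac_deriv (k%:R - beta) 0 (jacobi c d j) (z + 1).
Proof.
move=> b1 b2 z1; rewrite -jint_frac //; [|by lra..].
rewrite /Rhat /jint; congr (_ * _); apply: eq_Rintegral => s _.
rewrite /jweight powRr0 mulr1 -powRN; congr (_ * _ `^ _); ring.
Qed.

(** The derivative relation replaces u A times the lower derivative of P_j by a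
    combination that contains P_(j+1); collecting that term creates the
    denominator 1 + u A Chat, which equals 1 + u / (j + 1). *)
Lemma frac_jacobi_recurrence (R : realType) (c d u x : R) (m j : nat) :
  -1 < c -> -1 < d -> 0 < u -> u < 1 -> 0 < x -> (1 <= j)%N ->
  frac_deriv u m.+1 (jacobi c d j.+1) x =
    (tildeA c d u j * (x - 1) - tildeB c d u j) * frac_deriv u m.+1 (jacobi c d j) x
    - tildeC c d u j * frac_deriv u m.+1 (jacobi c d j.-1) x
    + m.+1%:R * tildeA c d u j * frac_deriv u m (jacobi c d j) x
    + u * tildeD c d u j * frac_kernel u m.+1 x 0.
Proof.
move=> hc hd u0 u1 x0 j1.
have jp : (1 : R) <= j%:R by rewrite ler1n.
pose P i := jacobi c d i; pose A := coefA c d j; pose B := Defs.coefB c d j.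
pose C := Defs.coefC c d j.
pose a := hatA c d j; pose b := hatB c d j; pose e := hatC c d j.
pose Q := a *: P j.-1 + b *: P j + e *: P j.+1.
have AeE : A * e = (j%:R + 1)^-1.
  by rewrite /A /e /coefA /hatC; field; do ?[apply/andP; split]; rewrite gt_eqF //; lra.
have den : 1 + u * A * e != 0.
  rewrite -mulrA AeE gt_eqF // addr_gt0 // mulr_gt0 // invr_gt0; lra.
have shift : frac_deriv u m (P j) x = frac_deriv u m.+1 Q x
    - Q.[-1] * frac_kernel u m.+1 x 0.
  by rewrite -frac_deriv_of_deriv /P jacobi_deriv.
have QE : frac_deriv u m.+1 Q x = a * frac_deriv u m.+1 (P j.-1) x
    + b * frac_deriv u m.+1 (P j) x + e * frac_deriv u m.+1 (P j.+1) x.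
  by rewrite !frac_derivD !frac_derivZ.
have rec : frac_deriv u m.+1 (P j.+1) x = A * (x * frac_deriv u m.+1 (P j) x
      + (m.+1%:R - u) * frac_deriv u m (P j) x)
    - (A + B) * frac_deriv u m.+1 (P j) x - C * frac_deriv u m.+1 (P j.-1) x.
  rewrite -frac_deriv_mulX1 //.
  rewrite /P jacobi_three_term // -/A -/B -/C.
  have -> : (A *: 'X - B%:P) * P j - C *: P j.-1 = A *: (('X + 1) * P j)
      + (- (A + B)) *: P j + (- C) *: P j.-1.
    by rewrite -!mul_polyC !(polyCN, polyCD); ring.
  by rewrite !frac_derivD !frac_derivZ; ring.
have QxE : Q.[-1] = a * (P j.-1).[-1] + b * (P j).[-1] + e * (P j.+1).[-1].
  by rewrite !hornerD !hornerZ.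
rewrite /tildeA /tildeB /tildeC /tildeD -/A -/B -/C -/a -/b -/e.
rewrite -[jacobi c d j.+1]/(P _) -[jacobi c d j]/(P _) -[jacobi c d j.-1]/(P _).
rewrite -QxE; move: rec shift; rewrite QE.
move: den.
move: (frac_deriv u m.+1 (P j.+1) x) (frac_deriv u m.+1 (P j) x)
  (frac_deriv u m.+1 (P j.-1) x) (frac_deriv u m (P j) x)
  (frac_kernel u m.+1 x 0) Q.[-1].
move: A B C a b e (m.+1%:R : R) {QE QxE AeE Q P hc hd jp j1}.
move=> A B C a b e M F1 F F0 G K q den rec shift.
apply: (mulfI den); set D := 1 + u * A * e in den *.
transitivity (A * (x - 1) * F - (B + u * A * b) * F - (C + u * A * a) * F0
    + M * A * G + u * (A * q) * K); last by field.
apply/eqP; rewrite -subr_eq0.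
have -> : D * F1 - (A * (x - 1) * F - (B + u * A * b) * F - (C + u * A * a) * F0
    + M * A * G + u * (A * q) * K)
  = (F1 - (A * (x * F + (M - u) * G) - (A + B) * F - C * F0))
    + u * A * ((a * F0 + b * F + e * F1 - q * K) - G) by rewrite /D; ring.
by rewrite -rec -shift !subrr mulr0 addr0.
Qed.

Theorem theorem3p4 (R : realType) (k m : nat) (hm : (1 <= m <= k)%N)
    (c d : R) (hc : -1 < c) (hd : -1 < d)
    (alpha : R -> R)
    (halpha : forall y : R, -1 < y <= 1 -> k%:R - 1 < alpha y < k%:R) :
  forall y : R, -1 < y <= 1 ->
  [/\ forall (j n : nat) (z : R), -1 < z ->
        derivable (derive1n n (Rhat k c d (alpha y) j)) z 1,
      derive1n m (Rhat k c d (alpha y) 0) y =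
        (y + 1) `^ (k%:R - alpha y - m%:R) / Gamma (k%:R - alpha y + 1 - m%:R),
      derive1n m (Rhat k c d (alpha y) 1) y =
        (jacobi c d 1).[-1] *
          ((y + 1) `^ (k%:R - alpha y - m%:R)
             / Gamma (k%:R - alpha y + 1 - m%:R))
        + (c + d + 2) / 2 *
          ((y + 1) `^ (k%:R - alpha y + 1 - m%:R)
             / Gamma (k%:R - alpha y + 2 - m%:R))
    & forall j : nat, (1 <= j)%N ->
      derive1n m (Rhat k c d (alpha y) j.+1) y =
        (tildeA c d (k%:R - alpha y) j * y - tildeB c d (k%:R - alpha y) j)
          * derive1n m (Rhat k c d (alpha y) j) y
        - tildeC c d (k%:R - alpha y) j * derive1n m (Rhat k c d (alpha y) j.-1) y
        + m%:R * tildeA c d (k%:R - alpha y) j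
          * derive1n m.-1 (Rhat k c d (alpha y) j) y
        + (k%:R - alpha y) * tildeD c d (k%:R - alpha y) j
          / Gamma (k%:R - alpha y + 1 - m%:R)
          * (y + 1) `^ (k%:R - alpha y - m%:R)].
Proof.
move=> y y1; have /andP[a1 a2] := halpha y y1; have /andP[ym _] := y1.
pose u := k%:R - alpha y.
have u0 : 0 < u by rewrite /u; lra.
have u1 : u < 1 by rewrite /u; lra.
have x0 : 0 < y + 1 by lra.
have RE j n := derive1n_frac u0 u1 (fun z => @Rhat_frac R k c d (alpha y) j z a1 a2) n.
have dE j n : derive1n n (Rhat k c d (alpha y) j) y = frac_deriv u n (jacobi c d j) (y + 1).
  by have [_ ->] := RE j n y ym.
case: m hm => [|m] // _.
have k0 : frac_kernel u m.+1 (y + 1) 0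
    = (y + 1) `^ (u - m.+1%:R) / Gamma (u + 1 - m.+1%:R).
  by rewrite /frac_kernel fact0 addr0 mul1r mulrC.
have k1 : frac_kernel u m.+1 (y + 1) 1
    = (y + 1) `^ (u + 1 - m.+1%:R) / Gamma (u + 2 - m.+1%:R).
  by rewrite /frac_kernel factS fact0 mul1r mulrC; congr (_ / Gamma _); ring.
split.
- by move=> j n z z1; have [] := RE j n z z1.
- by rewrite dE jacobi0 // -polyC1 frac_derivC mul1r k0.
- rewrite dE [in LHS]jacobi1 // frac_derivD frac_derivC frac_derivZ frac_derivX1.
  by rewrite k0 k1.
- move=> j j1; rewrite !dE frac_jacobi_recurrence // k0 addrK.
  by rewrite -/u; congr (_ + _); ring.
Qed.
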